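(* Let $0<\alpha\le\infty$, let $0\neq g\in L_1[0,\alpha)+L_\infty[0,\alpha)$, $G(t)=\int_0^t\mu(g)$, let $M_G$ be the corresponding Marcinkiewicz space on $[0,\alpha)$ and let $k$ be any natural number. A function $f\in M_G$ is a $k$-extreme point of $B_{M_G}$ if and only if $\mu(f)=\mu(g)$ and $|f|\geq\mu(\infty,f)$ a.e. on $[0,\alpha)$. Consequently, $f$ is a $k$-extreme point of $B_{M_G}$ if and only if $f$ is an extreme point of $B_{M_G}$.
   Context: Let $m$ be Lebesgue measure and $L^0[0,\alpha)$ the space of complex-valued measurable functions on $[0,\alpha)$, mod a.e. equality. For $f\in L^0[0,\alpha)$, $d(\lambda,f)=m\{t:|f(t)|>\lambda\}$ and $\mu(t,f)=\inf\{s>0:d(s,f)\le t\}$, $t\ge0$, is its decreasing rearrangement; $\mu(\infty,f)=\lim_{t\to\infty}\mu(t,f)$. When $\alpha<\infty$, $\mu(t,f)=0$ for $t\ge\alpha$, and $\mu(f)$ is identified with its restriction to $[0,\alpha)$. The Marcinkiewicz space $M_G$ is the set of all $f\in L^0[0,\alpha)$ such that $\|f\|_{M_G}=\sup_{t>0}\frac{\int_0^t\mu(f)}{\int_0^t\mu(g)}<\infty$, equipped with the norm $\|\cdot\|_{M_G}$. For $k\in\mathbb{N}$ and a complex normed space $X$ of dimension at least $k+1$ with unit sphere $S_X$ and closed unit ball $B_X$, a point $x\in S_X$ is a $k$-extreme point of $B_X$ if whenever $x=\frac1{k+1}\sum_{i=1}^{k+1}x_i$ with all $x_i\in S_X$,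 the elements $x_1,\dots,x_{k+1}$ are linearly dependent. ($1$-extreme points are exactly the extreme points of $B_X$.) *)

(* Defs.v *)
From HB Require Import structures.
From mathcomp Require Import all_boot all_order all_algebra complex.
From mathcomp Require Import all_classical all_reals all_analysis.
Set Implicit Arguments.
Unset Strict Implicit.
Unset Printing Implicit Defensive.
Import Order.TTheory GRing.Theory Num.Theory.
Import numFieldNormedType.Exports.
Local Open Scope classical_set_scope.
Local Open Scope ring_scope.

(* Elements of L^0[0,alpha) are represented by functions on the whole line whose
   values outside [0,alpha) are irrelevant; equality in L^0[0,alpha) is equality
   almost everywhere on [0,alpha).  Measurability is with respect to the Borel
   sets, which yields the same classes as Lebesgue measurability. *)

Definition dom (R : realType) (alpha : \bar R) : set R :=
  [set t : R | 0 <= t /\ (t%:E < alpha)%E].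

Definition cabs (R : realType) (z : complex R) : R := ComplexField.Normc.normc z.

Definition L0 (R : realType) (alpha : \bar R) (f : R -> complex R) : Prop :=
  measurable_fun (dom alpha) (fun t => complex.Re (f t)) /\
  measurable_fun (dom alpha) (fun t => complex.Im (f t)).

Definition ae_on (R : realType) (alpha : \bar R) (P : R -> Prop) : Prop :=
  {ae @lebesgue_measure R, forall t : R, dom alpha t -> P t}.

Definition L1 (R : realType) (alpha : \bar R) (f : R -> complex R) : Prop :=
  L0 alpha f /\
  (\int[@lebesgue_measure R]_(t in dom alpha) (cabs (f t))%:E < +oo)%E.

Definition Loo (R : realType) (alpha : \bar R) (f : R -> complex R) : Prop :=
  L0 alpha f /\ exists M : R, ae_on alpha (fun t => cabs (f t) <= M).

Definition L1_plus_Loo (R : realType) (alpha : \bar R) (g : R -> complex R) : Prop :=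
  L0 alpha g /\
  exists g1 g2 : R -> complex R,
    [/\ L1 alpha g1, Loo alpha g2 & ae_on alpha (fun t => g t = g1 t + g2 t)].

Definition distr (R : realType) (alpha : \bar R) (f : R -> complex R) (s : R) :
    \bar R :=
  @lebesgue_measure R (dom alpha `&` [set t | s < cabs (f t)]).

(* The infimum is taken in the extended reals: it is +oo when the set is empty. *)
Definition rearr (R : realType) (alpha : \bar R) (f : R -> complex R) (t : R) :
    \bar R :=
  ereal_inf [set s%:E | s in [set s : R | 0 < s /\ (distr alpha f s <= t%:E)%E]].

Definition rearr_oo (R : realType) (alpha : \bar R) (f : R -> complex R) : \bar R :=
  lim (rearr alpha f t @[t --> +oo%R]).

Definition int_rearr (R : realType) (alpha : \bar R) (f : R -> complex R) (t : R) :
    \bar R :=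
  (\int[@lebesgue_measure R]_(s in `[0%R, t]%classic) rearr alpha f s)%E.

Definition normM (R : realType) (alpha : \bar R) (g f : R -> complex R) : \bar R :=
  ereal_sup [set (int_rearr alpha f t / int_rearr alpha g t)%E
            | t in [set t : R | 0 < t]].

Definition inM (R : realType) (alpha : \bar R) (g f : R -> complex R) : Prop :=
  L0 alpha f /\ (normM alpha g f < +oo)%E.

Definition ballM (R : realType) (alpha : \bar R) (g f : R -> complex R) : Prop :=
  inM alpha g f /\ (normM alpha g f <= 1)%E.

Definition sphereM (R : realType) (alpha : \bar R) (g f : R -> complex R) : Prop :=
  inM alpha g f /\ normM alpha g f = 1%E.

Definition lin_dep (R : realType) (alpha : \bar R) (n : nat)
    (x : 'I_n -> R -> complex R) : Prop :=
  exists c : 'I_n -> complex R,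
    (exists i, c i != 0) /\ ae_on alpha (fun t => \sum_(i < n) c i * x i t = 0).

Definition k_extreme (R : realType) (alpha : \bar R) (g : R -> complex R) (k : nat)
    (f : R -> complex R) : Prop :=
  sphereM alpha g f /\
  forall x : 'I_k.+1 -> R -> complex R,
    (forall i, sphereM alpha g (x i)) ->
    ae_on alpha (fun t => f t = k.+1%:R^-1 * \sum_(i < k.+1) x i t) ->
    lin_dep alpha x.

Definition extreme (R : realType) (alpha : \bar R) (g f : R -> complex R) : Prop :=
  ballM alpha g f /\
  forall (y z : R -> complex R) (l : R),
    ballM alpha g y -> ballM alpha g z -> 0 < l < 1 ->
    ae_on alpha (fun t => f t = l%:C%C * y t + (1 - l)%:C%C * z t) ->
    ae_on alpha (fun t => y t = z t).

(* Main.v *)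
Require Import Defs.
From HB Require Import structures.
From mathcomp Require Import all_boot all_order all_algebra complex.
From mathcomp Require Import all_classical all_reals all_analysis.
From mathcomp Require Import measurable_realfun ring lra.
Set Implicit Arguments.
Unset Strict Implicit.
Unset Printing Implicit Defensive.
Import Order.TTheory GRing.Theory Num.Theory.
Import numFieldNormedType.Exports.
Local Open Scope classical_set_scope.
Local Open Scope ring_scope.

(** Write [Phi_f s] for the integral of the positive part of [|f| - s], the
    [excess] of [f] over the level [s].  The partial integrals of the rearrangement
    and the excess determine each other by convex duality: the integral of [mu(f)]
    over [[0, t]] is the minimum over [s] of [s * t + Phi_f s] ([int_rearr_le],
    [int_rearr_eq]), and [Phi_f s] is the supremum over [t] of that integral minus
    [s * t] ([excess_le_conj]).  Therefore [f] is in the unit ball of [M_G] if and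
    only if [Phi_f <= Phi_g] ([ballM_excess]), and [Phi_f s] is a convex function
    of [f].  This yields the triangle inequality ([int_rearr_lincomb]), by which an
    extreme point is [k]-extreme ([extreme_k_extreme]).  It remains to see that the
    two conditions imply extremality and follow from [k]-extremality.

    Sufficiency ([equimeasurable_extreme]).  If [mu(f) = mu(g)] then
    [Phi_f = Phi_g].  When [f] is a convex combination of [y] and [z] in the ball,
    the convexity inequality for [Phi] is an equality, and so is the pointwise one
    almost everywhere, for every level [s] with [Phi_f s] finite, in particular for
    every [s > mu(oo, f)].  Hence [|f| <= s] implies [|y| <= s] and [|z| <= s] for
    these levels, and, as [|f| >= mu(oo, f)], both [|y|] and [|z|] are at most [|f|].
    Strict convexity of the complex plane gives [y = z].

    Necessity.  A [k]-extreme point [f] is rigid: there is no bounded set [D] of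
    positive measure on which every small perturbation of [f] of zero weighted mean
    stays in the ball, because perturbing by suitable polynomials gives [k + 1]
    linearly independent functions with mean [f] ([k_extreme_rigid]).  In terms of the excess:
    if [Phi_f p < Phi_g q] for some levels [p < q], then [f] takes no values between
    [p] and [q], up to a null set ([k_extreme_gap]), and a similar statement holds
    for the values of [f] below which [Phi_g] is infinite ([k_extreme_floor]).  The
    latter shows [|f| >= mu(oo, f)].  Suppose now that [Phi_f s < Phi_g s].  On the
    largest interval of levels around [s] that avoids the values of [f], [Phi_f] is
    affine while [Phi_g] is convex, so the strict inequality persists towards one of
    the ends of this interval, where it contradicts one of the two statements
    ([gap_above], [gap_below]).  So [Phi_f = Phi_g], and the right derivatives give
    equal distribution functions and rearrangements. *)

(** * Measurability *)

Section measurability.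
Context {R : realType} (alpha : \bar R).
Implicit Types (f x y : R -> complex R) (s t : R).
Local Notation mu := (@lebesgue_measure R).

Lemma measurable_dom : measurable (dom alpha).
Proof.
apply: is_interval_measurable => x y [x0 xa] [y0 ya] z /andP[xz zy].
split; first exact: le_trans xz.
by apply: le_lt_trans ya; rewrite lee_fin.
Qed.

Lemma cabs_ge0 (z : complex R) : 0 <= cabs z.
Proof. by case: z => a b; exact: sqrtr_ge0. Qed.

Lemma cabs_real (r : R) : cabs r%:C%C = `|r|.
Proof. by rewrite /cabs /= expr0n addr0 sqrtr_sqr. Qed.

Lemma cabs_eq0 (z : complex R) : (cabs z == 0) = (z == 0).
Proof.
apply/eqP/eqP => [|->]; first exact: ComplexField.Normc.eq0_normc.
exact: ComplexField.Normc.normc0.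
Qed.

Lemma measurable_cabs (D : set R) f :
  measurable_fun D (fun t => complex.Re (f t)) ->
  measurable_fun D (fun t => complex.Im (f t)) ->
  measurable_fun D (fun t => cabs (f t)).
Proof.
move=> mr mi; rewrite (_ : (fun t => _) = @Num.sqrt R \o
  (fun t => complex.Re (f t) ^+ 2 + complex.Im (f t) ^+ 2)).
  apply: measurableT_comp.
    by apply: continuous_measurable_fun; exact: sqrt_continuous.
  by apply: measurable_funD; exact: measurable_funX.
by apply/funext => t; rewrite /cabs /comp; case: (f t).
Qed.

Lemma L0_cabs f : L0 alpha f -> measurable_fun (dom alpha) (fun t => cabs (f t)).
Proof. by case; exact: measurable_cabs. Qed.

Lemma L0_cst (c : complex R) : L0 alpha (fun=> c).
Proof. by split. Qed.

Lemma L0D x y : L0 alpha x -> L0 alpha y -> L0 alpha (fun t => x t + y t).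
Proof.
move=> [xr xi] [yr yi]; split.
  rewrite (_ : (fun t => _) =
    (fun t => complex.Re (x t) + complex.Re (y t))); first exact: measurable_funD.
  by apply/funext => t; case: (x t) (y t) => ? ? [].
rewrite (_ : (fun t => _) =
  (fun t => complex.Im (x t) + complex.Im (y t))); first exact: measurable_funD.
by apply/funext => t; case: (x t) (y t) => ? ? [].
Qed.

Lemma L0M x y : L0 alpha x -> L0 alpha y -> L0 alpha (fun t => x t * y t).
Proof.
move=> [xr xi] [yr yi]; split.
  rewrite (_ : (fun t => _) = (fun t => complex.Re (x t) * complex.Re (y t)
     - complex.Im (x t) * complex.Im (y t))).
    by apply: measurable_funB; exact: measurable_funM.
  by apply/funext => t; case: (x t) (y t) => ? ? [].
rewrite (_ : (fun t => _) = (fun t => complex.Re (x t) * complex.Im (y t)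
     + complex.Im (x t) * complex.Re (y t))).
  by apply: measurable_funD; exact: measurable_funM.
by apply/funext => t; case: (x t) (y t) => ? ? [].
Qed.

Lemma L0_sum (I : Type) (r : seq I) (P : pred I) (x : I -> R -> complex R) :
  (forall i, P i -> L0 alpha (x i)) ->
  L0 alpha (fun t => \sum_(i <- r | P i) x i t).
Proof.
move=> mx; elim: r => [|i r IH].
  rewrite (_ : (fun t => _) = fun=> 0); first exact: L0_cst.
  by apply/funext => t; rewrite big_nil.
have [Pi|Pi] := boolP (P i).
  rewrite (_ : (fun t => _) = fun t => x i t + \sum_(j <- r | P j) x j t).
    by apply: L0D => //; exact: mx.
  by apply/funext => t; rewrite big_cons Pi.
rewrite (_ : (fun t => _) = fun t => \sum_(j <- r | P j) x j t) //.
by apply/funext => t; rewrite big_cons (negbTE Pi).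
Qed.

Lemma L0_real (h : R -> R) : measurable_fun (dom alpha) h ->
  L0 alpha (fun t => (h t)%:C%C).
Proof. by move=> mh; split. Qed.

(** Tonelli's theorem for the indicator function of the region under the graph. *)
Lemma layer_cake (D : set R) (h : R -> \bar R) : measurable D ->
  measurable_fun D h -> (forall t, D t -> (0 <= h t)%E) ->
  (\int[mu]_(t in D) h t =
   \int[mu]_(r in `[0%R, +oo[) mu (D `&` [set t | r%:E < h t]))%E.
Proof.
move=> mD mh h0.
pose F (p : R * R) : \bar R :=
  (\1_[set q : R * R | (0 <= q.2)%R /\ (q.2%:E < (h \_ D) q.1)%E] p)%:E.
have hD0 t : (0 <= (h \_ D) t)%E by apply: erestrict_ge0.
have mhD : measurable_fun setT (h \_ D) by apply/(measurable_restrictT h).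
have mF : measurable_fun setT F.
  apply/measurable_EFinP/measurable_indic.
  rewrite (_ : [set q : R * R | _] =
     ((setT `&` [set q : R * R | (cst 0%E q <= (EFin \o snd) q)%E])
      `&` (setT `&` [set q : R * R | ((EFin \o snd) q < ((h \_ D) \o fst) q)%E]))); last first.
    by rewrite !setTI; apply/seteqP; split => q /=; rewrite lee_fin.
  apply: measurableI.
    apply: measurable_lee => //.
    by apply: measurableT_comp => //; exact: measurable_snd.
  apply: measurable_lte => //.
    by apply: measurableT_comp => //; exact: measurable_snd.
  by apply: measurableT_comp => //; exact: measurable_fst.
have F0 p : (0 <= F p)%E by rewrite lee_fin.
transitivity (\int[mu]_t \int[mu]_r F (t, r))%E.
  rewrite integral_mkcond; apply: eq_integral => t _.
  rewrite (_ : (fun r => F (t, r)) =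
    (fun r => (\1_[set r | (0 <= r)%R /\ (r%:E < (h \_ D) t)%E] r)%:E)) //.
  move: (hD0 t); case: ((h \_ D) t) => [c c0| _|//].
    rewrite (_ : [set r | _] = `[0, c[%classic); last first.
      by apply/seteqP; split => r /=; rewrite in_itv/= lte_fin => /andP.
    rewrite integral_indic//= setIT lebesgue_measure_itv/= lte_fin.
    move: c0; rewrite lee_fin le_eqVlt => /predU1P[<-|->]; last by rewrite sube0.
    by rewrite ltxx.
  rewrite (_ : [set r | _] = `[0, +oo[%classic); last first.
    by apply/seteqP; split => r /=; rewrite in_itv/= andbT ltry// => -[].
  by rewrite integral_indic//= setIT lebesgue_measure_itv/= ltry addye.
rewrite fubini_tonelli// [RHS]integral_mkcond; apply: eq_integral => r _.
rewrite patchE; case: ifPn.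
  rewrite inE/= in_itv/= andbT => r0.
  rewrite (_ : (fun t => F (t, r)) =
    (fun t => (\1_(D `&` [set t | (r%:E < h t)%E]) t)%:E)); last first.
    apply/funext => t; rewrite /F !indicE; congr (_%:R%:E); congr (nat_of_bool _).
    apply/idP/idP; rewrite !inE/= patchE.
      by move=> [_]; case: ifPn => [|_]; rewrite ?inE// lte_fin ltNge r0.
    by move=> [Dt ?]; split => //; rewrite mem_set.
  rewrite integral_indic//; first by rewrite setIT.
  exact: emeasurable_fun_o_infty.
rewrite notin_setE/= in_itv/= andbT => /negP r0.
rewrite integral0_eq// => t _; rewrite /F indicE memNset//= => -[] r1.
by rewrite r1 in r0.
Qed.

End measurability.

(** * Distribution function and excess *)

Ltac max_lra := repeat match goal with
  | |- context [Order.max ?x ?y] => case: (leP x y) => ? end; lra.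

(** The integral of the part of [|f|] above the level [s].  Unlike the rearrangement
    it depends on [f] through an integral over the domain, and it is convex in [f]. *)
Definition excess {R : realType} (alpha : \bar R) (f : R -> complex R) (s : R)
    : \bar R :=
  (\int[@lebesgue_measure R]_(t in dom alpha) (Num.max (cabs (f t) - s) 0)%:E)%E.

Section distribution_and_excess.
Context {R : realType} (alpha : \bar R) (f : R -> complex R).
Hypothesis mf : L0 alpha f.
Local Notation mu := (@lebesgue_measure R).
Local Notation d := (distr alpha f).
Local Notation Phi := (excess alpha f).

Let mabs : measurable_fun (dom alpha) (fun t => cabs (f t)) := L0_cabs mf.
Let mdom := measurable_dom alpha.

Lemma measurable_superlevel s :
  measurable (dom alpha `&` [set t | s < cabs (f t)]).
Proof.
rewrite (_ : [set t | _] = [set t | (s%:E < (cabs (f t))%:E)%E]); last first.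
  by apply/seteqP; split => t /=; rewrite lte_fin.
by apply: emeasurable_fun_o_infty => //; exact/measurable_EFinP.
Qed.

Lemma measurable_excess_fun s :
  measurable_fun (dom alpha) (fun t => (Num.max (cabs (f t) - s) 0)%:E).
Proof.
apply/measurable_EFinP; apply: measurable_maxr => //.
exact: measurable_funB.
Qed.

Lemma measurable_sublevel s :
  measurable (dom alpha `&` [set t | cabs (f t) <= s]).
Proof.
rewrite (_ : _ `&` _ = dom alpha `\` (dom alpha `&` [set t | s < cabs (f t)])).
  by apply: measurableD => //; exact: measurable_superlevel.
rewrite setDIr setDv set0U; apply/seteqP; split => t [Dt /= h]; split => //=.
  by apply/negP; rewrite -leNgt.
by rewrite leNgt; exact/negP.
Qed.

Lemma distr_ge0 s : (0 <= d s)%E.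
Proof. exact: measure_ge0. Qed.

Lemma excess_ge0 s : (0 <= Phi s)%E.
Proof. by apply: integral_ge0 => t _; rewrite lee_fin le_max lexx orbT. Qed.

Lemma distr_le s s' : s <= s' -> (d s' <= d s)%E.
Proof.
move=> ss'; apply: le_measure; rewrite ?inE; do ?exact: measurable_superlevel.
by move=> t [Dt /= st]; split => //=; exact: le_lt_trans st.
Qed.

Lemma distr_le_dom s : (d s <= mu (dom alpha))%E.
Proof. by apply: le_measure; rewrite ?inE//; exact: measurable_superlevel. Qed.

(** Right continuity, from the continuity of the measure along increasing sets: the
    distribution function is nonincreasing, so only a drop to the right of [s] has
    to be excluded. *)
Lemma distr_right_cont s (c : \bar R) : (c < d s)%E ->
  exists2 s', s < s' & (c < d s')%E.
Proof.
move=> cd; apply: contrapT => H.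
have {}H s' : s < s' -> (d s' <= c)%E.
  by move=> ss'; rewrite leNgt; apply/negP => cs'; apply: H; exists s'.
pose F n := dom alpha `&` [set t | s + harmonic n < cabs (f t)].
have UF : \bigcup_n F n = dom alpha `&` [set t | s < cabs (f t)].
  apply/seteqP; split => t.
    move=> [n _ [Dt /= st]]; split => //=; apply: lt_trans st.
    by rewrite ltrDl harmonic_gt0.
  move=> [Dt /= st]; have : 0 < cabs (f t) - s by rewrite subr_gt0.
  move=> /ltr_add_invr[n]; rewrite add0r => hn.
  exists n => //; split => //=; rewrite -ltrBrDl.
  by apply: le_lt_trans hn; rewrite /harmonic.
have : (mu \o F) n @[n --> \oo] --> d s.
  rewrite /distr -UF; apply: nondecreasing_cvg_mu.
  - by move=> i; exact: measurable_superlevel.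
  - by rewrite UF; exact: measurable_superlevel.
  move=> n m nm; rewrite subsetEset => t [Dt /= st]; split => //=.
  apply: le_lt_trans st; rewrite lerD2l /harmonic lef_pV2 ?posrE//.
  by rewrite ler_nat.
move=> /cvge_to_le => /(_ c); rewrite leNgt cd => h.
suff : false by [].
by apply: h; apply: nearW => n; apply: H; rewrite ltrDl harmonic_gt0.
Qed.

Lemma excess_le s s' : s <= s' -> (Phi s' <= Phi s)%E.
Proof.
move=> ss'; apply: ge0_le_integral => //.
- by move=> t _; rewrite lee_fin le_max lexx orbT.
- exact: measurable_excess_fun.
- exact: measurable_excess_fun.
move=> t _; rewrite lee_fin ge_max !le_max lexx orbT andbT.
by rewrite lerD2l lerN2 ss'.
Qed.

(** Right continuity, by monotone convergence as the level decreases to [s]. *)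
Lemma excess_right_cont s (c : \bar R) : (c < Phi s)%E ->
  exists2 s', s < s' & (c < Phi s')%E.
Proof.
move=> cd; apply: contrapT => H.
have {}H s' : s < s' -> (Phi s' <= c)%E.
  by move=> ss'; rewrite leNgt; apply/negP => cs'; apply: H; exists s'.
pose F n t := (Num.max (cabs (f t) - (s + harmonic n)) 0)%:E.
have F0 n t : (0 <= F n t)%E by rewrite lee_fin le_max lexx orbT.
have limF t : limn (F ^~ t) = (Num.max (cabs (f t) - s) 0)%:E.
  apply/cvg_lim => //; apply: cvg_EFin; first exact: nearW.
  rewrite [X in X @ _ --> _](_ : _ =
     (fun r => Num.max (cabs (f t) - r) 0) \o (fun n => s + harmonic n)) //.
  apply: continuous_cvg.
    apply: (@continuous_max _ _ (fun r : R => cabs (f t) - r) (fun=> 0)).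
      by apply: continuousB; [exact: cvg_cst|exact: cvg_id].
    exact: cvg_cst.
  rewrite -[X in _ --> X]addr0; apply: cvgD; first exact: cvg_cst.
  exact: cvg_harmonic.
have : (\int[mu]_(t in dom alpha) F n t)%E @[n --> \oo] --> Phi s.
  rewrite /excess; under eq_integral do rewrite -limF.
  apply: cvg_monotone_convergence => //.
    by move=> n; exact: measurable_excess_fun.
  move=> t _ n m nm; rewrite lee_fin ge_max !le_max lexx orbT andbT.
  apply/orP; left; rewrite lerD2l lerN2 lerD2l /harmonic lef_pV2 ?posrE//.
  by rewrite ler_nat.
move=> /cvge_to_le => /(_ c); rewrite leNgt cd => h.
suff : false by [].
by apply: h; apply: nearW => n; apply: H; rewrite ltrDl harmonic_gt0.
Qed.

Let step (r c u t : R) : \bar R := ((Num.max (cabs (f t) - r) 0)%:E +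
  c%:E * (\1_(dom alpha `&` [set t | u < cabs (f t)]) t)%:E)%E.

Let measurable_jump (c u : R) : measurable_fun (dom alpha)
  (fun t : R => c%:E * (\1_(dom alpha `&` [set t | u < cabs (f t)]) t)%:E)%E.
Proof.
apply: emeasurable_funM => //; apply/measurable_EFinP.
by apply: measurable_indic; exact: measurable_superlevel.
Qed.

Let measurable_step r c u : measurable_fun (dom alpha) (step r c u).
Proof. exact: emeasurable_funD (measurable_excess_fun r) (measurable_jump c u). Qed.

Let step_ge0 r c u t : 0 <= c -> (0 <= step r c u t)%E.
Proof.
by move=> c0; rewrite adde_ge0 ?mule_ge0 ?lee_fin// le_max lexx orbT.
Qed.

Let step_integral u r c : 0 <= c ->
  (\int[mu]_(t in dom alpha) step r c u t = Phi r + c%:E * d u)%E.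
Proof.
move=> c0; rewrite ge0_integralD; [|exact: mdom| |exact: measurable_excess_fun
  | |exact: measurable_jump]; last 2 first.
- by move=> t _; rewrite lee_fin le_max lexx orbT.
- by move=> t _; apply: mule_ge0; rewrite ?lee_fin.
rewrite ge0_integralZl//; last first.
  by apply/measurable_EFinP; apply: measurable_indic; exact: measurable_superlevel.
rewrite integral_indic//; last exact: measurable_superlevel.
by rewrite setIC setIA setIid.
Qed.

(** Between the levels [s] and [s'] the graph of the excess, a convex function, lies
    between the lines with slopes minus the distribution function at either end: the
    positive part drops by at most [s' - s], only where [|f|] exceeds [s], and by
    exactly [s' - s] where [|f|] exceeds [s']. *)
Lemma excess_distr_le s s' : s <= s' ->
  (Phi s' + (s' - s)%:E * d s' <= Phi s)%E.
Proof.
move=> ss'; have c0 : 0 <= s' - s by rewrite subr_ge0.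
rewrite -(step_integral s' s')//; apply: ge0_le_integral => //.
- by move=> t _; exact: step_ge0.
- exact: measurable_step.
- exact: measurable_excess_fun.
move=> t Dt; rewrite /step -EFinM -EFinD lee_fin indicE.
have [st|st] := ltP s' (cabs (f t)).
  by rewrite mem_set//= mulr1; max_lra.
rewrite memNset/= ?mulr0 ?addr0; last by move=> [_]; rewrite ltNge st.
by max_lra.
Qed.

Lemma excess_le_distr s s' : s <= s' ->
  (Phi s <= Phi s' + (s' - s)%:E * d s)%E.
Proof.
move=> ss'; have c0 : 0 <= s' - s by rewrite subr_ge0.
rewrite -(step_integral s s')//; apply: ge0_le_integral => //.
- by move=> t _; rewrite lee_fin le_max lexx orbT.
- exact: measurable_excess_fun.
- exact: measurable_step.
move=> t Dt; rewrite /step -EFinM -EFinD lee_fin indicE.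
have [st|st] := ltP s (cabs (f t)).
  by rewrite mem_set//= mulr1; max_lra.
rewrite memNset/= ?mulr0 ?addr0; last by move=> [_]; rewrite ltNge st.
by max_lra.
Qed.

Lemma distr_fin s s' : s < s' -> (Phi s < +oo)%E -> (d s' < +oo)%E.
Proof.
move=> ss' fin; have := excess_distr_le (ltW ss').
case: (d s') (distr_ge0 s') => [r _ _|_|//]; first exact: ltry.
rewrite gt0_muley ?lte_fin ?subr_gt0// addey ?leye_eq; first by
  move=> /eqP H; rewrite H in fin.
by rewrite -ltNye (lt_le_trans _ (excess_ge0 s'))// ltNy0.
Qed.

Lemma excess_infty s s' : s < s' -> d s' = +oo%E -> Phi s = +oo%E.
Proof.
move=> ss' dy; apply/eqP; rewrite -leye_eq leNgt; apply/negP => /(distr_fin ss').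
by rewrite dy ltxx.
Qed.

End distribution_and_excess.

(** * Conjugacy of the excess and the rearrangement *)

Section rearrangement.
Context {R : realType} (alpha : \bar R) (f : R -> complex R).
Hypothesis mf : L0 alpha f.
Local Notation mu := (@lebesgue_measure R).
Local Notation d := (distr alpha f).
Local Notation Phi := (excess alpha f).
Local Notation rho := (rearr alpha f).
Local Notation F := (int_rearr alpha f).

Lemma rearr_ge0 t : (0 <= rho t)%E.
Proof.
by apply: le_ereal_inf_tmp => _ [s [s0 _] <-]; rewrite lee_fin ltW.
Qed.

Lemma rearr_le t t' : t <= t' -> (rho t' <= rho t)%E.
Proof.
move=> tt'; apply: ereal_inf_le_tmp => _ [s [s0 ds] <-].
by exists s => //; split => //; apply: le_trans ds _; rewrite lee_fin.
Qed.

(** The rearrangement and the distribution function are generalized inverses of each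
    other; the inequalities are strict because the latter is right continuous. *)
Lemma lt_rearr s t : 0 <= s -> (s%:E < rho t)%E = (t%:E < d s)%E.
Proof.
move=> s0; apply/idP/idP => [sr|td].
  rewrite ltNge; apply/negP => ds.
  have le_rho s' : s < s' -> (rho t <= s'%:E)%E.
    move=> ss'; apply: ereal_inf_lbound; exists s' => //; split.
      exact: le_lt_trans ss'.
    exact: le_trans (distr_le mf (ltW ss')) ds.
  move: sr; rewrite ltNge => /negP; apply; apply/lee_addgt0Pr => e e0.
  by apply: le_rho; rewrite ltrDl.
have [s' ss' td'] := distr_right_cont mf td.
apply: (@lt_le_trans _ _ s'%:E); first by rewrite lte_fin.
apply: le_ereal_inf_tmp => _ [r [r0 dr] <-]; rewrite lee_fin leNgt.
apply/negP => rs'; move: (distr_le mf (ltW rs')).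
by rewrite leNgt (le_lt_trans dr td').
Qed.

Lemma measurable_rearr (D : set R) : measurable D -> measurable_fun D rho.
Proof.
move=> mD; apply: (@measurable_funS _ _ _ _ setT) => //.
apply: (measurability _ (ErealGenOInfty.measurableE R)).
move=> _ [_ [r ->] <-]; rewrite setTI.
have [r0|r0] := ltP r 0.
  rewrite (_ : _ @^-1` _ = setT) //; apply/seteqP; split => // t _ /=.
  by rewrite in_itv/= andbT (lt_le_trans _ (rearr_ge0 t)).
rewrite (_ : _ @^-1` _ = [set t | (t%:E < d r)%E]); last first.
  by apply/seteqP; split => t /=; rewrite in_itv/= andbT lt_rearr.
apply: is_interval_measurable => x y _ /= yd z /andP[_ zy].
by apply: le_lt_trans yd; rewrite lee_fin.
Qed.


Let surplus (s t : R) : \bar R := (maxe (rho t - s%:E) 0)%E.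

Let surplus_ge0 s t : (0 <= surplus s t)%E.
Proof. by rewrite /surplus le_max lexx orbT. Qed.

Let measurable_surplus s (D : set R) : measurable D -> measurable_fun D (surplus s).
Proof.
move=> mD; apply: measurable_maxe; last exact: measurable_cst.
exact: emeasurable_funB (measurable_rearr mD) (measurable_cst _).
Qed.

(** [f] and its rearrangement are equimeasurable: by the layer-cake formula both
    sides are the integral of the distribution function over the levels above [s]. *)
Lemma excess_rearr s : 0 <= s ->
  Phi s = (\int[mu]_(t in `[0%R, +oo[) maxe (rho t - s%:E) 0)%E.
Proof.
move=> s0; rewrite /excess layer_cake; last 3 first.
- exact: measurable_dom.
- exact: measurable_excess_fun.
- by move=> t _; rewrite lee_fin le_max lexx orbT.
rewrite [RHS](@layer_cake _ _ (surplus s))//; last exact: measurable_surplus.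
apply: eq_integral => r; rewrite inE/= in_itv/= andbT => r0.
transitivity (d (s + r)).
  congr (mu _); apply/seteqP; split => t [Dt] /=; rewrite ?lte_fin => h.
    split => //=; move: h; rewrite lt_max ltrBrDl => /orP[//|].
    by rewrite ltNge r0.
  by split => //=; rewrite lt_max ltrBrDl h.
have sr0 : 0 <= s + r by exact: addr_ge0.
rewrite (_ : _ `&` _ = `[0, +oo[%classic `&` [set t | (t%:E < d (s + r))%E]); last first.
  apply/seteqP; split => t [t0] /= h; split => //=.
    move: h; rewrite -lt_rearr// lt_max => /orP[|].
      by rewrite lteBrDl// EFinD.
    by rewrite lte_fin ltNge r0.
  by rewrite lt_max lteBrDl// -EFinD lt_rearr// h.
have := distr_ge0 alpha f (s + r); case: (d (s + r)) => [c c0| _|//].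
  rewrite (_ : _ `&` _ = `[0, c[%classic); last first.
    apply/seteqP; split => t /=; rewrite !in_itv/= andbT lte_fin; first by case=> -> ->.
    by move=> /andP.
  rewrite lebesgue_measure_itv/= lte_fin.
  move: c0; rewrite lee_fin le_eqVlt => /predU1P[<-|->]; last by rewrite sube0.
  by rewrite ltxx.
rewrite (_ : _ `&` _ = `[0, +oo[%classic); last first.
  by apply/seteqP; split => t /=; rewrite ltry// => -[].
by rewrite lebesgue_measure_itv/= ltry addye.
Qed.

Let lebesgue_0 t : 0 <= t -> mu `[0, t]%classic = t%:E.
Proof.
rewrite lebesgue_measure_itv/= lte_fin le_eqVlt => /predU1P[<-|->]; last by rewrite sube0.
by rewrite ltxx.
Qed.

Let integral_surplusD s t : 0 <= s -> 0 <= t ->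
  (\int[mu]_(r in `[0%R, t]) (surplus s r + s%:E) =
   \int[mu]_(r in `[0%R, t]) surplus s r + (s * t)%:E)%E.
Proof.
move=> s0 t0; rewrite ge0_integralD//; last first.
  exact: measurable_surplus.
by rewrite integral_cst//= lebesgue_0// EFinM.
Qed.

(** The rearrangement lies below [s] plus its surplus over [s].  Together with the
    case of equality [int_rearr_eq] this makes the partial integral at [t] the
    minimum over the levels [s] of [s * t] plus the excess over [s]. *)
Lemma int_rearr_le s t : 0 <= s -> 0 <= t -> (F t <= (s * t)%:E + Phi s)%E.
Proof.
move=> s0 t0; apply: (@le_trans _ _ (\int[mu]_(r in `[0%R, t]) (surplus s r + s%:E))%E).
  apply: ge0_le_integral => //.
  - by move=> r _; exact: rearr_ge0.
  - exact: measurable_rearr.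
  - by apply: emeasurable_funD; [exact: measurable_surplus|exact: measurable_cst].
  - by move=> r _; rewrite -leeBlDr// le_max lexx.
rewrite integral_surplusD// addeC leeD2l// excess_rearr//.
apply: ge0_subset_integral => //.
  exact: measurable_surplus.
by move=> r /=; rewrite !in_itv/= => /andP[->].
Qed.

Lemma int_rearr_eq s t : 0 <= t -> rho t = s%:E -> F t = ((s * t)%:E + Phi s)%E.
Proof.
move=> t0 rts; have s0 : 0 <= s by rewrite -lee_fin -rts rearr_ge0.
transitivity (\int[mu]_(r in `[0%R, t]) (surplus s r + s%:E))%E.
  apply: eq_integral => r; rewrite inE/= in_itv/= => /andP[r0 rt].
  have := rearr_le rt; rewrite rts /surplus => h.
  by rewrite max_l ?sube_ge0// subeK.
rewrite integral_surplusD// addeC; congr adde; rewrite excess_rearr//.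
rewrite integral_mkcond [RHS]integral_mkcond; apply: eq_integral => r _.
rewrite !patchE; case: ifPn; rewrite ?inE ?notin_setE/= in_itv/=.
  by move=> /andP[r0 _]; rewrite mem_set//= in_itv/= r0.
move=> h; case: ifPn => //; rewrite inE/= in_itv/= andbT => r0.
move: h; rewrite r0/= => /negP; rewrite -ltNge => tr.
rewrite /surplus max_r; first by [].
by rewrite EFinN leeBlDr// add0e -rts; apply: rearr_le; exact: ltW.
Qed.

(** The converse conjugacy: the excess over [s] is the supremum over [t] of the
    partial integral at [t] minus [s * t].  The optimal [t] is [distr alpha f s],
    truncated in the proof to stay finite. *)
Lemma excess_le_conj s (c : \bar R) : 0 <= s -> (0 <= c)%E ->
  (forall t, 0 < t -> (F t <= (s * t)%:E + c)%E) -> (Phi s <= c)%E.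
Proof.
move=> s0 c0 Fc; rewrite excess_rearr//.
have cup : \bigcup_n `[0%R, n%:R]%classic = `[0%R, +oo[%classic :> set R.
  apply/seteqP; split => t; first by move=> [n _] /=; rewrite !in_itv/= => /andP[->].
  rewrite /= in_itv/= andbT => t0; exists (Num.truncn t).+1 => //=.
  by rewrite in_itv/= t0/= ltW// truncnS_gt.
have : (\int[mu]_(t in `[0%R, n%:R]) surplus s t)%E @[n --> \oo] -->
    (\int[mu]_(t in \bigcup_n `[0%R, n%:R]%classic) surplus s t)%E.
  apply: (@ge0_nondecreasing_set_cvg_integral _ (measurableTypeR R) _
    (fun n => `[0, n%:R]%classic) (surplus s) mu).
  - move=> n m nm; rewrite subsetEset => t /=; rewrite !in_itv/= => /andP[->/= tn].
    by rewrite (le_trans tn)// ler_nat.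
  - by move=> n; exact: measurable_itv.
  - by move=> n; apply: (measurable_surplus s); exact: measurable_itv.
  - by move=> n t _; exact: surplus_ge0.
rewrite cup => /cvge_to_le; apply; apply: nearW => n.
(* [t'] is the minimum of [n] and [distr alpha f s]. *)
have [t' [t'0 t'n lt_t']] : exists t', [/\ 0 <= t', t' <= n%:R &
    forall t, 0 <= t <= n%:R -> (s%:E < rho t)%E =
      (t < t') || ((t == n%:R) && (s%:E < rho t)%E)].
  have [nd|dn] := leP n%:R%:E (d s).
    exists n%:R; split => // t /andP[t0 tn]; move: (tn); rewrite le_eqVlt => /predU1P[->|tn'].
      by rewrite ltxx eqxx.
    by rewrite tn' lt_rearr// (lt_le_trans _ nd)// lte_fin.
  have := distr_ge0 alpha f s.
  move: dn; case E : (d s) => [r| |]//; rewrite lte_fin lee_fin => rn r0.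
  exists r; split => //; first exact: ltW.
  move=> t /andP[t0 tn]; rewrite lt_rearr// E lte_fin.
  by have [->|] := eqVneq t n%:R; rewrite ?orbF//= orbb.
have split_int : (\int[mu]_(t in `[0%R, n%:R]) surplus s t =
    \int[mu]_(t in `[0%R, t'[) surplus s t)%E.
  rewrite -integral_itv_bndo_bndc; last exact: measurable_surplus.
  rewrite integral_mkcond [RHS]integral_mkcond; apply: eq_integral => t _.
  rewrite !patchE; case: ifPn; rewrite ?inE ?notin_setE/= in_itv/=.
    move=> /andP[t0 tn]; case: ifPn => //; rewrite notin_setE/= in_itv/= t0/= => /negP.
    move=> tt'; have := lt_t' t; rewrite t0 ltW//= => /(_ erefl).
    rewrite (negbTE tt') (lt_eqF tn)/= => /negbT; rewrite -leNgt => h.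
    by rewrite /surplus max_r// leeBlDr// add0e.
  move=> h; case: ifPn => //; rewrite inE/= in_itv/= => /andP[t0 tt'].
  by move: h; rewrite t0/= (lt_le_trans tt' t'n).
rewrite [X in (X <= _)%E]split_int.
move: t'0; rewrite le_eqVlt => /predU1P[<-|t'0].
  by rewrite set_itvco0 integral_set0.
have := Fc _ t'0; rewrite addeC -leeBlDr//; apply: le_trans.
rewrite leeBrDr// /int_rearr -integral_itv_bndo_bndc; last exact: measurable_rearr.
rewrite (_ : (s * t')%:E = \int[mu]_(t in `[0%R, t'[) cst s%:E t)%E; last first.
  by rewrite integral_cst//= lebesgue_measure_itv/= lte_fin t'0 sube0 -EFinM.
rewrite -ge0_integralD//; last exact: measurable_surplus.
apply: ge0_le_integral => //.
- by move=> t _; rewrite adde_ge0.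
- by apply: emeasurable_funD; [exact: measurable_surplus|exact: measurable_cst].
- exact: measurable_rearr.
move=> t /=; rewrite in_itv/= => /andP[t0 tt'].
have := lt_t' t; rewrite t0 (le_trans (ltW tt'))//= => /(_ erefl).
rewrite tt'/= => h; rewrite /surplus max_l ?subeK//.
by rewrite leeBrDr// add0e ltW.
Qed.

Lemma rearr_le_int t : 0 <= t -> (t%:E * rho t <= F t)%E.
Proof.
move=> t0; rewrite muleC -[X in (_ * X)%E]lebesgue_0// -integral_cst//.
apply: ge0_le_integral => //.
- by move=> *; exact: rearr_ge0.
- exact: measurable_rearr.
- by move=> r /=; rewrite in_itv/= => /andP[_ rt]; exact: rearr_le.
Qed.

Lemma rearr_ooE : rearr_oo alpha f = ereal_inf (range rho).
Proof.
apply: cvg_lim => //; apply: nonincreasing_cvge => t t'; exact: rearr_le.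
Qed.

End rearrangement.

(** * Subadditivity of the partial integrals *)

Section rearrangement_norm.
Context {R : realType} (alpha : \bar R).
Local Notation mu := (@lebesgue_measure R).
Implicit Types f g h : R -> complex R.

Lemma ae_onS (P Q : R -> Prop) : (forall t, dom alpha t -> P t -> Q t) ->
  ae_on alpha P -> ae_on alpha Q.
Proof.
move=> PQ; apply: (@filterS _ _ (ae_filter_ringOfSetsType mu)) => t Pt Dt.
exact: PQ (Pt Dt).
Qed.

Lemma ae_onS2 (P Q S : R -> Prop) :
  (forall t, dom alpha t -> P t -> Q t -> S t) ->
  ae_on alpha P -> ae_on alpha Q -> ae_on alpha S.
Proof.
move=> PQS; apply: (@filterS2 _ _ (ae_filter_ringOfSetsType mu)) => t Pt Qt Dt.
exact: PQS (Pt Dt) (Qt Dt).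
Qed.

Lemma cabsM (z w : complex R) : cabs (z * w) = cabs z * cabs w.
Proof. exact: ComplexField.Normc.normcM. Qed.

Lemma cabsD (z w : complex R) : cabs (z + w) <= cabs z + cabs w.
Proof. exact: le_normcD. Qed.

Lemma cabs_sum (I : Type) (r : seq I) (P : pred I) (z : I -> complex R) :
  cabs (\sum_(i <- r | P i) z i) <= \sum_(i <- r | P i) cabs (z i).
Proof.
elim/big_ind2: _ => // [|z1 x1 z2 x2 h1 h2].
  by rewrite (cabs_real 0) normr0.
exact: le_trans (cabsD _ _) (lerD h1 h2).
Qed.

Lemma distr_ae f h s : L0 alpha f -> L0 alpha h ->
  ae_on alpha (fun t => cabs (f t) = cabs (h t)) -> distr alpha f s = distr alpha h s.
Proof.
move=> mf mh fh.
have E x : L0 alpha x -> distr alpha x s = (\int[mu]_(t in dom alpha)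
    (\1_(dom alpha `&` [set t | (s < cabs (x t))%R]) t)%:E)%E.
  move=> mx; rewrite integral_indic; [|exact: measurable_dom|exact: measurable_superlevel].
  by rewrite setIC setIA setIid.
rewrite !E//; apply: ge0_ae_eq_integral => //.
- exact: measurable_dom.
- by apply/measurable_EFinP; apply: measurable_indic; exact: measurable_superlevel.
- by apply/measurable_EFinP; apply: measurable_indic; exact: measurable_superlevel.
- apply: ae_onS fh => t Dt fht; congr (_%:E); rewrite !indicE; congr (_%:R).
  by congr (nat_of_bool _); apply/idP/idP; rewrite !inE/= fht.
Qed.

Lemma int_rearr_ae f h t : L0 alpha f -> L0 alpha h ->
  ae_on alpha (fun t => f t = h t) -> int_rearr alpha f t = int_rearr alpha h t.
Proof.
move=> mf mh fh; apply: eq_integral => r _; congr ereal_inf.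
suff E s : distr alpha f s = distr alpha h s.
  by apply/seteqP; split => _ [s [s0 ds] <-]; exists s => //; split => //;
    rewrite ?E// -E.
by apply: distr_ae => //; apply: ae_onS fh => u _ ->.
Qed.

Lemma rearr_fin f t : L0 alpha f -> 0 < t -> (int_rearr alpha f t < +oo)%E ->
  rearr alpha f t = (fine (rearr alpha f t))%:E.
Proof.
move=> mf t0 Ft; rewrite fineK// ge0_fin_numE ?rearr_ge0//.
rewrite ltey; apply/eqP => ry.
by have := rearr_le_int mf (ltW t0); rewrite ry gt0_muley// leNgt Ft.
Qed.

Lemma excess_fin_rearr f t : L0 alpha f -> 0 < t -> (int_rearr alpha f t < +oo)%E ->
  (excess alpha f (fine (rearr alpha f t)) < +oo)%E.
Proof.
move=> mf t0 Ft; apply: le_lt_trans (Ft).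
rewrite (int_rearr_eq mf (ltW t0) (rearr_fin mf t0 Ft)).
by apply: lee_paddl => //; rewrite lee_fin; apply: mulr_ge0;
  [exact/fine_ge0/rearr_ge0|exact: ltW].
Qed.

(** Since [int_rearr] is a minimum over [s] of [s * t] plus the excess over [s], and
    the positive part is convex, optimal levels for the summands combine into an
    admissible level for the sum. *)
Lemma int_rearr_lincomb n (c : 'I_n -> complex R) (x : 'I_n -> R -> complex R) t :
  (forall i, L0 alpha (x i)) -> 0 < t ->
  (forall i, (int_rearr alpha (x i) t < +oo)%E) ->
  (int_rearr alpha (fun u => (\sum_(i < n) c i * x i u)%R) t <=
   \sum_(i < n) (cabs (c i))%:E * int_rearr alpha (x i) t)%E.
Proof.
move=> mx t0 Fx; pose s i := fine (rearr alpha (x i) t).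
have s0 i : 0 <= s i by rewrite fine_ge0// rearr_ge0.
have mcx : L0 alpha (fun u => \sum_(i < n) c i * x i u).
  by apply: L0_sum => i _; apply: L0M => //; exact: L0_cst.
have cs0 : 0 <= \sum_(i < n) cabs (c i) * s i.
  by apply: sumr_ge0 => i _; rewrite mulr_ge0 ?cabs_ge0.
apply: le_trans (int_rearr_le mcx cs0 (ltW t0)) _.
rewrite (_ : \sum_(i < n) _ = ((\sum_(i < n) cabs (c i) * s i) * t)%:E +
   \sum_(i < n) (cabs (c i))%:E * excess alpha (x i) (s i))%E; last first.
  rewrite mulr_suml -sumEFin -big_split/=; apply: eq_bigr => i _.
  rewrite (int_rearr_eq (mx i) (ltW t0) (rearr_fin (mx i) t0 (Fx i))).
  rewrite ge0_muleDr; [| |exact: excess_ge0]; last first.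
    by rewrite lee_fin; apply: mulr_ge0; [exact: s0|exact: ltW].
  by rewrite -EFinM mulrA.
rewrite leeD2l//.
rewrite (eq_bigr (fun i => \int[mu]_(u in dom alpha) ((cabs (c i))%:E *
    (Num.max (cabs (x i u) - s i) 0)%:E))%E) => [|i _]; last first.
  rewrite ge0_integralZl ?lee_fin ?cabs_ge0//.
  - exact: measurable_dom.
  - exact: measurable_excess_fun.
  - by move=> u _; rewrite lee_fin le_max lexx orbT.
rewrite -ge0_integral_sum; [|exact: measurable_dom| |]; last 2 first.
- move=> i; apply: emeasurable_funM; first exact: measurable_cst.
  exact: measurable_excess_fun.
- by move=> i u _; rewrite -EFinM lee_fin mulr_ge0 ?cabs_ge0// le_max lexx orbT.
apply: ge0_le_integral.
- exact: measurable_dom.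
- by move=> u _; rewrite lee_fin le_max lexx orbT.
- exact: measurable_excess_fun.
- apply: emeasurable_sum => i; apply: emeasurable_funM; first exact: measurable_cst.
  exact: measurable_excess_fun.
move=> u _; rewrite (eq_bigr (fun i =>
  (cabs (c i) * Num.max (cabs (x i u) - s i) 0)%:E)) => [|i _]; last by rewrite EFinM.
rewrite sumEFin lee_fin ge_max sumr_ge0 ?andbT => [|i _]; last first.
  by rewrite mulr_ge0 ?cabs_ge0// le_max lexx orbT.
rewrite lerBlDr -big_split/=; apply: le_trans (cabs_sum _ _ _) _.
apply: ler_sum => i _; rewrite cabsM -mulrDr ler_wpM2l ?cabs_ge0//.
by rewrite -lerBlDr le_max lexx.
Qed.

End rearrangement_norm.

(** * The unit ball of the Marcinkiewicz space *)

Section unit_ball.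
Context {R : realType} (alpha : \bar R) (g : R -> complex R).
Local Notation mu := (@lebesgue_measure R).
Local Notation G := (int_rearr alpha g).
Hypothesis gL : L1_plus_Loo alpha g.
Hypothesis g_neq0 : ~ ae_on alpha (fun t => g t = 0).
Implicit Types f : R -> complex R.

Let mg : L0 alpha g := gL.1.

(** Above the essential bound of the bounded summand only the integrable summand
    contributes to the excess. *)
Lemma int_rearr_generator_fin t : 0 < t -> (G t < +oo)%E.
Proof.
move=> t0; have [_ [g1 [g2 [[mg1 ig1] [mg2 [M0 bg2]] gE]]]] := gL.
pose M := Num.max M0 0; have M_ge0 : 0 <= M by rewrite le_max lexx orbT.
apply: le_lt_trans (int_rearr_le mg M_ge0 (ltW t0)) _.
apply: lte_add_pinfty; first exact: ltry.
apply: le_lt_trans ig1; apply: ae_ge0_le_integral.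
- exact: measurable_dom.
- by move=> u _; rewrite lee_fin le_max lexx orbT.
- exact: measurable_excess_fun.
- by move=> u _; rewrite lee_fin cabs_ge0.
- by apply/measurable_EFinP; exact: L0_cabs.
apply: ae_onS2 bg2 gE => u _ b ->.
rewrite lee_fin ge_max cabs_ge0 andbT lerBlDr.
by apply: le_trans (cabsD _ _) _; rewrite lerD2l le_max b.
Qed.

Lemma distr_generator_gt0 : (0 < distr alpha g 0)%E.
Proof.
rewrite lt_neqAle distr_ge0 andbT eq_sym; apply/eqP => d0; apply: g_neq0.
have : mu.-negligible (dom alpha `&` [set t | 0 < cabs (g t)]).
  by apply/negligibleP => //; exact: measurable_superlevel.
apply: negligibleS => t /= /not_implyP[Dt gt]; split => //=.
by rewrite lt_neqAle cabs_ge0 andbT eq_sym cabs_eq0; apply/eqP.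
Qed.

Lemma int_rearr_generator_gt0 t : 0 < t -> (0 < G t)%E.
Proof.
move=> t0; have [s s0 ds] := distr_right_cont mg distr_generator_gt0.
have [t' t'0 [t't t'd]] : exists2 t', 0 < t' & t' <= t /\ (t'%:E < distr alpha g s)%E.
  case: (distr alpha g s) ds => [r|_|//].
    rewrite lte_fin => r0; exists (Num.min t (r / 2)).
      by rewrite lt_min t0 divr_gt0.
    rewrite ge_min lexx lte_fin; split => //.
    by rewrite gt_min ltr_pdivrMr// ltr_pMr// ltr1n orbT.
  by exists t => //; rewrite ltry.
apply: (@lt_le_trans _ _ (G t')).
  apply: lt_le_trans (rearr_le_int mg (ltW t'0)).
  apply: mule_gt0; first by rewrite lte_fin.
  rewrite (@lt_trans _ _ s%:E)// ?lte_fin// lt_rearr//; exact: ltW.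
apply: ge0_subset_integral => //.
- exact: measurable_rearr.
- by move=> u _; exact: rearr_ge0.
- by move=> u /=; rewrite !in_itv/= => /andP[-> ut]; rewrite (le_trans ut).
Qed.

Let G_fin t : 0 < t -> exists2 r, 0 < r & G t = r%:E.
Proof.
move=> t0; exists (fine (G t)).
  by apply: fine_gt0; rewrite int_rearr_generator_gt0// int_rearr_generator_fin.
by rewrite fineK// gt0_fin_numE ?int_rearr_generator_fin// int_rearr_generator_gt0.
Qed.

Lemma normM_le f c : (normM alpha g f <= c%:E)%E <->
  (forall t, 0 < t -> (int_rearr alpha f t <= c%:E * G t)%E).
Proof.
split=> [fc t t0|fc].
  have [r r0 Gr] := G_fin t0; rewrite Gr -lee_pdivrMr//.
  apply: le_trans fc; apply: ereal_sup_ubound; exists t => //.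
  by rewrite Gr inver gt_eqF.
apply: ge_ereal_sup => _ [t t0 <-]; have := fc _ t0.
by have [r r0 ->] := G_fin t0; rewrite inver gt_eqF// lee_pdivrMr.
Qed.

Lemma normM_ge0 f : (0 <= normM alpha g f)%E.
Proof.
apply: (@le_trans _ _ (int_rearr alpha f 1 / G 1)%E); last first.
  by apply: ereal_sup_ubound; exists 1 => //=.
apply: mule_ge0; first by apply: integral_ge0 => t _; exact: rearr_ge0.
by have [r r0 ->] := G_fin (@ltr01 R); rewrite inver gt_eqF// lee_fin invr_ge0 ltW.
Qed.

Lemma inM_fin f t : inM alpha g f -> 0 < t -> (int_rearr alpha f t < +oo)%E.
Proof.
move=> [mf nf] t0; have [r r0 Gr] := G_fin t0.
have /normM_le/(_ _ t0) : (normM alpha g f <= (fine (normM alpha g f))%:E)%E.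
  by rewrite fineK// ge0_fin_numE// normM_ge0.
by move=> /le_lt_trans; apply; rewrite Gr -EFinM ltry.
Qed.

Lemma ballMP f : L0 alpha f -> ballM alpha g f <->
  (forall t, 0 < t -> (int_rearr alpha f t <= G t)%E).
Proof.
move=> mf; split => [[_ /normM_le h] t t0|h].
  by rewrite -[X in (_ <= X)%E]mul1e h.
have n1 : (normM alpha g f <= 1)%E by apply/normM_le => t t0; rewrite mul1e h.
by split => //; split => //; apply: le_lt_trans n1 _; exact: ltry.
Qed.

(** The partial integrals and the excess are conjugate to each other, so membership
    in the unit ball can be read off from the excess, which, unlike the
    rearrangement, is a convex functional. *)
Lemma ballM_excess f : L0 alpha f -> ballM alpha g f <->
  (forall s, 0 <= s -> (excess alpha f s <= excess alpha g s)%E).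
Proof.
move=> mf; apply: (iff_trans (ballMP mf)); split => h.
  move=> s s0; apply: excess_le_conj => //; first exact: excess_ge0.
  by move=> t t0; apply: le_trans (h _ t0) _; apply: int_rearr_le => //; exact: ltW.
move=> t t0.
have Gt := int_rearr_generator_fin t0.
rewrite [X in (_ <= X)%E](int_rearr_eq mg (ltW t0) (rearr_fin mg t0 Gt)).
have s0 : 0 <= fine (rearr alpha g t) by exact/fine_ge0/rearr_ge0.
by apply: le_trans (int_rearr_le mf s0 (ltW t0)) _; rewrite leeD2l// h.
Qed.

Lemma normM_lincomb n (c : 'I_n -> complex R) (x : 'I_n -> R -> complex R)
    (r : 'I_n -> R) :
  (forall i, L0 alpha (x i)) -> (forall i, (normM alpha g (x i) <= (r i)%:E)%E) ->
  (normM alpha g (fun u => (\sum_(i < n) c i * x i u)%R) <=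
   (\sum_(i < n) cabs (c i) * r i)%:E)%E.
Proof.
move=> mx xr; apply/normM_le => t t0; have [p p0 Gp] := G_fin t0.
have xF i : (int_rearr alpha (x i) t <= (r i * p)%:E)%E.
  by have /normM_le/(_ _ t0) := xr i; rewrite Gp.
apply: le_trans (int_rearr_lincomb c mx t0 _) _ => [i|].
  by apply: le_lt_trans (xF i) _; exact: ltry.
rewrite Gp -EFinM mulr_suml -sumEFin; apply: lee_sum => i _.
by rewrite -mulrA EFinM lee_wpmul2l// lee_fin cabs_ge0.
Qed.

Lemma normM_ae f h : L0 alpha f -> L0 alpha h -> ae_on alpha (fun t => f t = h t) ->
  normM alpha g f = normM alpha g h.
Proof.
move=> mf mh fh;
pose N (a : R -> \bar R) := ereal_sup [set (a t / G t)%E | t in [set t : R | 0 < t]].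
apply: (congr1 N (x := int_rearr alpha f) (y := int_rearr alpha h)).
by apply/funext => t; exact: int_rearr_ae.
Qed.

End unit_ball.

(** * Extreme points are k-extreme *)

Section extreme_points.
Context {R : realType} (alpha : \bar R) (g : R -> complex R).
Local Notation mu := (@lebesgue_measure R).
Hypothesis gL : L1_plus_Loo alpha g.
Hypothesis g_neq0 : ~ ae_on alpha (fun t => g t = 0).
Implicit Types f : R -> complex R.

Let mg : L0 alpha g := gL.1.

Lemma cabs_natV n : cabs (n%:R^-1 : complex R) = n%:R^-1 :> R.
Proof.
rewrite (_ : n%:R^-1 = (n%:R^-1)%:C%C).
  by rewrite cabs_real ger0_norm// invr_ge0.
by rewrite fmorphV rmorph_nat.
Qed.

Lemma ballM_fin_real f : ballM alpha g f ->
  exists2 r, 0 <= r <= 1 & normM alpha g f = r%:E.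
Proof.
move=> [[mf nf] n1]; exists (fine (normM alpha g f)).
  by rewrite fine_ge0 ?normM_ge0//= -lee_fin fineK// ge0_fin_numE// normM_ge0.
by rewrite fineK// ge0_fin_numE// normM_ge0.
Qed.

(** If a mean of unit-ball vectors has norm one, none of them can fall short of
    norm one, by the triangle inequality. *)
Lemma sphereM_mean k f (x : 'I_k.+1 -> R -> complex R) :
  sphereM alpha g f -> (forall i, ballM alpha g (x i)) ->
  ae_on alpha (fun t => f t = k.+1%:R^-1 * \sum_(i < k.+1) x i t) ->
  forall i, sphereM alpha g (x i).
Proof.
move=> [[mf _] f1] bx fx j; split; first by have [] := bx j.
have mx i : L0 alpha (x i) by have [[]] := bx i.
have [r /andP[r0 r1] xjr] := ballM_fin_real (bx j).
move: r1; rewrite le_eqVlt xjr => /predU1P[->//|r1].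
pose rr i := if i == j then r else 1.
have xr i : (normM alpha g (x i) <= (rr i)%:E)%E.
  by rewrite /rr; case: eqP => [->|_]; [rewrite xjr|case: (bx i)].
have := normM_lincomb gL g_neq0 (fun=> k.+1%:R^-1) mx xr.
rewrite -(@normM_ae _ _ _ f) //; last 2 first.
- by apply: L0_sum => i _; apply: L0M => //; exact: L0_cst.
- by apply: ae_onS fx => t _ ->; rewrite mulr_sumr.
rewrite f1 lee_fin -mulr_sumr cabs_natV (bigD1 j)//= /rr eqxx.
rewrite (eq_bigr (fun=> 1)) => [|i /negbTE->//].
rewrite sumr_const cardC1 card_ord/= ler_pdivlMl ?ltr0n// mulr1.
by rewrite -natr1 [_ + 1]addrC lerD2r leNgt r1.
Qed.

(** A function [f] of norm [r < 1] is the midpoint of [f + (1 - r) g] and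
    [f - (1 - r) g], and [g] itself has norm one. *)
Lemma extreme_sphereM f : extreme alpha g f -> sphereM alpha g f.
Proof.
move=> [bf ef]; split; first by case: bf.
have [r /andP[r0]] := ballM_fin_real bf.
rewrite le_eqVlt => /predU1P[->//|r1] fr.
have mf : L0 alpha f by case: bf => -[].
have bc (e : R) : `|e| = 1 - r ->
    ballM alpha g (fun t => f t + e%:C%C * g t).
  move=> er.
  pose c (i : 'I_2) : complex R := if i == ord0 then 1 else e%:C%C.
  pose x (i : 'I_2) := if i == ord0 then f else g.
  pose rr (i : 'I_2) : R := if i == ord0 then r else 1.
  have mx i : L0 alpha (x i) by rewrite /x; case: eqP.
  have xr i : (normM alpha g (x i) <= (rr i)%:E)%E.
    rewrite /x /rr; case: eqP => _; first by rewrite fr.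
    by apply/(normM_le gL g_neq0) => t _; rewrite mul1e.
  have := normM_lincomb gL g_neq0 c mx xr.
  rewrite (_ : (fun u => _) = (fun t => f t + e%:C%C * g t)); last first.
    by apply/funext => t; rewrite big_ord_recl big_ord1 /c /x/= mul1r.
  have -> : \sum_(i < 2) cabs (c i) * rr i = 1.
    rewrite big_ord_recl big_ord1 /c /rr eqxx eq_sym (negbTE (neq_lift _ _)).
    by rewrite cabs_real er (cabs_real 1) normr1 mul1r mulr1 subrKC.
  move=> n1; split => //; split.
    by apply: L0D => //; apply: L0M => //; exact: L0_cst.
  by apply: le_lt_trans n1 _; exact: ltry.
have l1 : 0 < 1 - r by rewrite subr_gt0.
exfalso; apply: g_neq0.
apply: ae_onS (ef _ _ 2^-1 (bc (1 - r) _) (bc (- (1 - r)) _) _ _).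
- move=> t _ /addrI; rewrite rmorphN mulNr => /eqP.
  rewrite -subr_eq0 opprK -mulr2n mulrn_eq0/= mulf_eq0 => /orP[|/eqP//].
  by rewrite fmorph_eq0 gt_eqF.
- by rewrite ger0_norm// ltW.
- by rewrite normrN ger0_norm// ltW.
- by rewrite invr_gt0 ltr0n invf_lt1 ?ltr1n.
apply: aeW => t _.
rewrite (_ : 1 - 2^-1 = 2^-1 :> R); last by lra.
set h := (2^-1)%:C%C; have hh : h + h = 1.
  by rewrite -rmorphD (_ : 2^-1 + 2^-1 = 1 :> R) ?rmorph1//; lra.
by rewrite -[LHS]mul1r -hh rmorphN; ring.
Qed.

(** The mean of [x_0, ..., x_k] is a proper convex combination of [x_0] and of the
    mean of the others; when the mean is extreme these two coincide. *)
Lemma extreme_k_extreme k f : (0 < k)%N -> extreme alpha g f -> k_extreme alpha g k f.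
Proof.
move=> k0 ef; split; first exact: extreme_sphereM.
move=> x sx fx.
have mx i : L0 alpha (x i) by have [[]] := sx i.
have kn0 : k%:R != 0 :> complex R by rewrite pnatr_eq0 -lt0n.
pose z t := \sum_(i < k) k%:R^-1 * x (lift ord0 i) t.
have bz : ballM alpha g z.
  have xr i : (normM alpha g (x (lift ord0 i)) <= 1%:E)%E by have [_ ->] := sx (lift ord0 i).
  have := normM_lincomb gL g_neq0 (fun=> k%:R^-1) (fun i => mx (lift ord0 i)) xr.
  rewrite -mulr_sumr cabs_natV sumr_const card_ord mulVf ?pnatr_eq0 -?lt0n// => n1.
  split => //; split; last by apply: le_lt_trans n1 _; exact: ltry.
  by apply: L0_sum => i _; apply: L0M => //; exact: L0_cst.
have bx0 : ballM alpha g (x ord0) by have [? n1] := sx ord0; split => //; rewrite n1.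
have l01 : 0 < (k.+1%:R^-1 : R) < 1.
  by rewrite invr_gt0 ltr0n invf_lt1 ?ltr0n// ltr1n ltnS.
have [_ /(_ _ _ _ bx0 bz l01)] := ef.
set ae := ae_on _ _ => H; have {}/H H : ae.
  have lC : (k.+1%:R^-1)%:C%C = k.+1%:R^-1 :> complex R.
    by rewrite fmorphV rmorph_nat.
  have lC' : (1 - k.+1%:R^-1)%:C%C = 1 - k.+1%:R^-1 :> complex R.
    by rewrite -lC rmorphB rmorph1.
  apply: ae_onS fx => t _ ->; rewrite big_ord_recl mulrDr /z -mulr_sumr mulrA.
  rewrite lC lC'; congr (_ + _ * _).
  have k1 : k.+1%:R != 0 :> complex R by rewrite pnatr_eq0.
  apply: (mulfI k1); rewrite divff// mulrA mulrBr divff// mulr1 -natr1 addrK.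
  by rewrite divff.
exists (fun i => if unlift ord0 i is Some _ then - k%:R^-1 else 1); split.
  by exists ord0; rewrite unlift_none oner_eq0.
apply: ae_onS H => t _ x0z; rewrite big_ord_recl unlift_none mul1r x0z /z.
apply/eqP; rewrite addr_eq0 -sumrN; apply/eqP; apply: eq_bigr => i _.
by rewrite liftK mulNr opprK.
Qed.

End extreme_points.

(** * Sufficiency: rearrangements of the generator are extreme *)

Section sufficiency.
Context {R : realType} (alpha : \bar R) (g : R -> complex R).
Local Notation mu := (@lebesgue_measure R).
Hypothesis gL : L1_plus_Loo alpha g.
Hypothesis g_neq0 : ~ ae_on alpha (fun t => g t = 0).
Implicit Types f : R -> complex R.

Let mg : L0 alpha g := gL.1.

Lemma cabs_sqr (z : complex R) : cabs z ^+ 2 = complex.Re z ^+ 2 + complex.Im z ^+ 2.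
Proof. by case: z => a b; rewrite /cabs/= sqr_sqrtr// addr_ge0 ?sqr_ge0. Qed.

(** Strict convexity of the complex plane: the square of the modulus of the convex
    combination is that of the squares minus [l (1 - l) |y - z|^2]. *)
Lemma cabs_strict_convex (l : R) (y z : complex R) : 0 < l < 1 ->
  cabs y <= cabs (l%:C%C * y + (1 - l)%:C%C * z) ->
  cabs z <= cabs (l%:C%C * y + (1 - l)%:C%C * z) -> y = z.
Proof.
move=> /andP[l0 l1]; set w := _ + _ => yw zw.
have {}yw : cabs y ^+ 2 <= cabs w ^+ 2 by rewrite ler_sqr ?nnegrE ?cabs_ge0.
have {}zw : cabs z ^+ 2 <= cabs w ^+ 2 by rewrite ler_sqr ?nnegrE ?cabs_ge0.
move: yw zw; rewrite !cabs_sqr /w.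
case: y z {w} => [a b] [c d] /=; set p := (X in X <= _); set q := (X in _ -> X <= _ -> _).
rewrite !mul0r !subr0 !addr0 => pn qn.
have H : l * (1 - l) * ((a - c) ^+ 2 + (b - d) ^+ 2) <= 0.
  have E : (l * a + (1 - l) * c) ^+ 2 + (l * b + (1 - l) * d) ^+ 2 =
      l * p + (1 - l) * q - l * (1 - l) * ((a - c) ^+ 2 + (b - d) ^+ 2).
    by rewrite /p /q; ring.
  move: pn qn; rewrite E; nra.
have {}H : (a - c) ^+ 2 + (b - d) ^+ 2 == 0.
  rewrite eq_le addr_ge0 ?sqr_ge0// andbT.
  by rewrite -(pmulr_rle0 _ (_ : 0 < l * (1 - l)))// mulr_gt0// subr_gt0.
move: H; rewrite paddr_eq0 ?sqr_ge0// !sqrf_eq0 !subr_eq0 => /andP[/eqP-> /eqP->].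
by [].
Qed.

Lemma excess_eq f h s : L0 alpha f -> L0 alpha h -> 0 <= s ->
  (forall t, 0 <= t -> rearr alpha f t = rearr alpha h t) ->
  excess alpha f s = excess alpha h s.
Proof.
move=> mf mh s0 fh; apply: (eq_trans (excess_rearr mf s0)).
apply: (eq_trans _ (esym (excess_rearr mh s0))); apply: eq_integral => t.
by rewrite inE/= in_itv/= andbT => t0; rewrite fh.
Qed.

Lemma int_rearr_eq_rearr f h t :
  (forall t, 0 <= t -> rearr alpha f t = rearr alpha h t) ->
  int_rearr alpha f t = int_rearr alpha h t.
Proof.
move=> fh; apply: eq_integral => u.
by rewrite inE/= in_itv/= => /andP[u0 _]; rewrite fh.
Qed.

(** Above the limit of the rearrangement lies some value [rearr alpha f t], over which
    the excess is at most the partial integral at [t]. *)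
Lemma excess_fin_rearr_oo f s : inM alpha g f ->
  (rearr_oo alpha f < s%:E)%E -> (excess alpha f s < +oo)%E.
Proof.
move=> fM; have mf := fM.1; rewrite rearr_ooE// => /ereal_inf_lt[_ [t _ <-] ts].
pose t' := Num.max t 1; have t'0 : 0 < t' by rewrite lt_max ltr01 orbT.
have Ft := inM_fin gL g_neq0 fM t'0.
apply: le_lt_trans (excess_fin_rearr mf t'0 Ft); apply: excess_le => //.
rewrite -lee_fin -rearr_fin//; apply: le_trans (ltW ts).
by apply: rearr_le; rewrite le_max lexx.
Qed.

(** Integrating the convexity inequality of the positive part leaves no room when
    the excess of [f] is finite and maximal, so that the inequality is an equality
    almost everywhere; where [f] does not exceed [s] this reads [0 = 0 + 0]. *)
Lemma convex_split_le f y z (l s : R) : L0 alpha f -> 0 <= s -> 0 < l < 1 ->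
  ballM alpha g y -> ballM alpha g z ->
  ae_on alpha (fun t => f t = l%:C%C * y t + (1 - l)%:C%C * z t) ->
  excess alpha f s = excess alpha g s -> (excess alpha f s < +oo)%E ->
  ae_on alpha (fun t => cabs (f t) <= s -> cabs (y t) <= s /\ cabs (z t) <= s).
Proof.
move=> mf s0 /andP[l0 l1] yball zball fyz fg ffin.
have my : L0 alpha y by case: yball => -[].
have mz : L0 alpha z by case: zball => -[].
have l1' : 0 < 1 - l by rewrite subr_gt0.
have mdom := measurable_dom alpha.
pose P (x : R -> complex R) (t : R) : R := Num.max (cabs (x t) - s) 0.
have mP x : L0 alpha x -> measurable_fun (dom alpha) (P x).
  by move=> mx; apply/measurable_EFinP; exact: measurable_excess_fun.
have P0 x t : 0 <= P x t by rewrite le_max lexx orbT.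
pose h (t : R) := l * P y t + (1 - l) * P z t.
have h0 t : 0 <= h t by rewrite addr_ge0// mulr_ge0// ltW.
have mh : measurable_fun (dom alpha) h.
  by apply: measurable_funD; apply: measurable_funM => //; exact: mP.
pose u (t : R) := Num.max (h t - P f t) 0.
have u0 t : 0 <= u t by rewrite le_max lexx orbT.
have meas_u : measurable_fun (dom alpha) u.
  by apply: measurable_maxr => //; apply: measurable_funB => //; exact: mP.
(* [h] dominates the positive part [P f] by convexity; [u] is the defect. *)
have Ph : ae_on alpha (fun t => P f t <= h t).
  apply: ae_onS fyz => t _ E; rewrite {1}/P E ge_max h0 andbT lerBlDr /h.
  apply: le_trans (cabsD _ _) _; rewrite !cabsM !cabs_real.
  rewrite (ger0_norm (ltW l0)) (ger0_norm (ltW l1')).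
  have Py : cabs (y t) - s <= P y t by rewrite le_max lexx.
  have Pz : cabs (z t) - s <= P z t by rewrite le_max lexx.
  have := ler_wpM2l (ltW l0) Py; have := ler_wpM2l (ltW l1') Pz; lra.
have inth : (\int[mu]_(t in dom alpha) (h t)%:E <= excess alpha g s)%E.
  have -> : (\int[mu]_(t in dom alpha) (h t)%:E = \int[mu]_(t in dom alpha)
      (l%:E * (P y t)%:E + (1 - l)%:E * (P z t)%:E))%E by [].
  rewrite ge0_integralD//; last 4 first.
  - by move=> t _; rewrite -EFinM lee_fin mulr_ge0// ltW.
  - by apply/measurable_EFinP; apply: measurable_funM => //; exact: mP.
  - by move=> t _; rewrite -EFinM lee_fin mulr_ge0// ltW.
  - by apply/measurable_EFinP; apply: measurable_funM => //; exact: mP.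
  have intZ c x : 0 < c -> L0 alpha x -> (\int[mu]_(t in dom alpha) (c%:E * (P x t)%:E) =
      c%:E * excess alpha x s)%E.
    move=> c0 mx; rewrite ge0_integralZl//.
    - by apply/measurable_EFinP; exact: mP.
    - by move=> t _; rewrite lee_fin.
    - by rewrite lee_fin ltW.
  rewrite (intZ l y)// (intZ (1 - l) z)//.
  have Ey := (ballM_excess gL g_neq0 my).1 yball _ s0.
  have Ez := (ballM_excess gL g_neq0 mz).1 zball _ s0.
  move: Ey Ez; rewrite -fg; set E := excess alpha f s => Ey Ez.
  rewrite (_ : E = l%:E * E + (1 - l)%:E * E)%E; last first.
    rewrite -ge0_muleDl ?lee_fin; [|exact: ltW|exact: ltW].
    by rewrite -EFinD subrKC mul1e.
  by apply: leeD; apply: lee_wpmul2l => //; rewrite lee_fin ltW.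
have : (\int[mu]_(t in dom alpha) (u t)%:E <= 0)%E.
  have : (excess alpha f s + \int[mu]_(t in dom alpha) (u t)%:E <=
      excess alpha f s)%E.
    rewrite [X in (_ <= X)%E]fg; apply: le_trans inth.
    have <- : (\int[mu]_(t in dom alpha) ((P f t)%:E + (u t)%:E) =
        excess alpha f s + \int[mu]_(t in dom alpha) (u t)%:E)%E.
      rewrite ge0_integralD; [by []|exact: mdom|by move=> t _; rewrite lee_fin|
        exact: measurable_excess_fun|by move=> t _; rewrite lee_fin|
        exact/measurable_EFinP].
    apply: ae_ge0_le_integral => //.
    - by move=> t _; rewrite -EFinD lee_fin addr_ge0// P0.
    - apply: emeasurable_funD; first exact: measurable_excess_fun.
      exact/measurable_EFinP.
    - by move=> t _; rewrite lee_fin.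
    - exact/measurable_EFinP.
    apply: ae_onS Ph => t _ Pht; rewrite -EFinD lee_fin -/(P f t) /u.
    by rewrite max_l ?subr_ge0// subrKC.
  by rewrite -[X in (_ <= X)%E -> _]adde0 leeD2lE// ge0_fin_numE// excess_ge0.
have uint0 : (0 <= \int[mu]_(t in dom alpha) (u t)%:E)%E.
  by apply: integral_ge0 => t _; rewrite lee_fin.
move=> ule0.
have : ae_eq mu (dom alpha) (EFin \o u) (cst 0%E).
  apply/ae_eq_integral_abs => //; first exact/measurable_EFinP.
  apply/eqP; rewrite eq_le; apply/andP; split; last exact: integral_ge0.
  apply: le_trans ule0; rewrite le_eqVlt; apply/orP; left; apply/eqP.
  by apply: eq_integral => t _ /=; rewrite ger0_norm.
apply: ae_onS => t _ /= [] ut fs.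
have hPf : h t <= P f t.
  by rewrite -subr_le0 -ut le_max lexx.
have Pf0 : P f t = 0 by rewrite /P max_r// subr_le0.
have Py : P y t <= 0.
  rewrite -(pmulr_rle0 _ l0) -Pf0; apply: le_trans hPf.
  by rewrite lerDl mulr_ge0// ltW.
have Pz : P z t <= 0.
  rewrite -(pmulr_rle0 _ l1') -Pf0; apply: le_trans hPf.
  by rewrite lerDr mulr_ge0// ltW.
by move: Py Pz; rewrite !ge_max !subr_le0 => /andP[-> _] /andP[->].
Qed.

(** Where [f] is at least the limit of its rearrangement, every rational level above
    [|f|] has finite excess, so that both [y] and [z] are bounded by [|f|] there;
    strict convexity of the complex plane forces [y = z]. *)
Lemma equimeasurable_extreme f : inM alpha g f ->
  (forall t, 0 <= t -> rearr alpha f t = rearr alpha g t) ->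
  ae_on alpha (fun t => (rearr_oo alpha f <= (cabs (f t))%:E)%E) ->
  extreme alpha g f.
Proof.
move=> fM fg foo; have mf := fM.1.
split.
  by apply/(ballMP gL g_neq0 mf) => t t0; rewrite (int_rearr_eq_rearr t fg).
move=> y z l yball zball l01 fyz.
(* [unpickle] turns the quantification over rational levels into one over [nat],
   which commutes with almost everywhere. *)
have aeq : {ae mu, forall t, forall n : nat, dom alpha t -> forall q : rat,
    unpickle n = Some q -> (rearr_oo alpha f < (ratr q)%:E)%E ->
    cabs (f t) <= ratr q -> cabs (y t) <= ratr q /\ cabs (z t) <= ratr q}.
  apply/ae_foralln => n; case: (unpickle n) => [q|]; last exact: aeW.
  have [fq|fq] := ltP (rearr_oo alpha f) (ratr q)%:E; last first.
    by apply: aeW => t _ ? [<-]; rewrite ltNge fq.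
  have q0 : 0 <= ratr q :> R.
    rewrite -lee_fin (le_trans _ (ltW fq))// rearr_ooE//.
    by apply: le_ereal_inf_tmp => _ [t _ <-]; exact: rearr_ge0.
  have := convex_split_le mf q0 l01 yball zball fyz (excess_eq mf mg q0 fg)
    (excess_fin_rearr_oo fM fq).
  by apply: ae_onS => t _ H ? [<-] _.
have : ae_on alpha (fun t => forall n (q : rat),
    unpickle n = Some q -> (rearr_oo alpha f < (ratr q)%:E)%E ->
    cabs (f t) <= ratr q -> cabs (y t) <= ratr q /\ cabs (z t) <= ratr q).
  move: aeq; apply: (@filterS _ _ (ae_filter_ringOfSetsType mu)) => t H Dt n q.
  exact: H.
move=> {aeq} H; have {}H := ae_onS2 (S := fun t => cabs (y t) <= cabs (f t) /\
  cabs (z t) <= cabs (f t)) _ foo H.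
apply: ae_onS2 (H _) fyz => [t _ [yf zf] E|t _ ft Hq].
  by apply: (cabs_strict_convex l01); rewrite -E.
have {}Hq (q : rat) : cabs (f t) < ratr q -> cabs (y t) <= ratr q /\ cabs (z t) <= ratr q.
  move=> fq; apply: (Hq (pickle q) q); rewrite ?pickleK//; last exact: ltW.
  by apply: le_lt_trans ft _; rewrite lte_fin.
split; rewrite leNgt; apply/negP => /rat_in_itvoo[q]; rewrite in_itv/= => /andP[fq].
  by rewrite ltNge; have [-> _] := Hq _ fq.
by rewrite ltNge; have [_ ->] := Hq _ fq.
Qed.

End sufficiency.

(** * Polynomial perturbations of zero weighted mean *)

Section polynomial_perturbations.
Context {R : realType} (alpha : \bar R).
Local Notation mu := (@lebesgue_measure R).
Implicit Types f : R -> complex R.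

Lemma bounded_integrable (D : set R) (h : R -> R) (M : R) : measurable D ->
  (mu D < +oo)%E -> measurable_fun D h -> (forall t, D t -> `|h t| <= M) ->
  mu.-integrable D (EFin \o h).
Proof.
move=> mD fD mh hM; apply: measurable_bounded_integrable => //.
by exists M; split => [|x Mx t Dt]; [exact: num_real|exact: le_trans (hM t Dt) (ltW Mx)].
Qed.

(** A set of positive measure is infinite, the zeros of a nonzero polynomial are
    finitely many. *)
Lemma poly_ae_eq0 (Q : {poly complex R}) (D : set R) : measurable D ->
  (0 < mu D)%E -> {ae mu, forall t, D t -> Q.[t%:C%C] = 0} -> Q = 0.
Proof.
move=> mD D0 Q0; apply/eqP; apply: contraT => Qn0.
have finZ : finite_set [set t : R | Q.[t%:C%C] = 0].
  apply: contrapT => /(infinite_set_fset (size Q))[B BZ sB].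
  suff : (size [seq t%:C%C | t <- finmap.enum_fset B] < size Q)%N.
    by rewrite size_map ltnNge sB.
  apply: max_poly_roots => //.
    by apply/allP => _ /mapP[t tB ->]; apply/rootP; exact: BZ.
  by rewrite map_inj_uniq ?finmap.fset_uniq// => a b [].
have : mu.-negligible D.
  apply: negligibleS (negligibleU Q0 _).
    2: apply/negligibleP; last exact/countable_lebesgue_measure0/finite_set_countable/finZ.
    2: exact/countable_measurable/finite_set_countable.
  move=> t Dt; have [Qt|Qt] := pselect (Q.[t%:C%C] = 0); [by right|left].
  by move=> /(_ Dt).
by move=> /negligibleP => /(_ mD) D00; rewrite D00 ltxx in D0.
Qed.

(** A direction of perturbation of [f] with a simple effect on the modulus: adding a
    small real multiple [h] of it multiplies [|f|] by [1 + h] where [f] does not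
    vanish, and changes it from [0] to [|h|] on the zeros of [f]. *)
Definition nonvanishing f (t : R) : complex R :=
  f t + (\1_(dom alpha `\` [set t | 0 < cabs (f t)]) t)%:C%C.

Lemma nonvanishingE f t : dom alpha t ->
  nonvanishing f t = if f t == 0 then 1 else f t.
Proof.
move=> Dt; rewrite /nonvanishing indicE; case: eqP => ft.
  by rewrite mem_set ?ft ?add0r//; split => //=; rewrite ft (cabs_real 0) normr0 ltxx.
rewrite memNset ?addr0// => -[_]; apply => /=.
by rewrite lt_neqAle cabs_ge0 andbT eq_sym cabs_eq0; apply/eqP.
Qed.

Lemma L0_nonvanishing f : L0 alpha f -> L0 alpha (nonvanishing f).
Proof.
move=> mf; apply: L0D => //; apply: L0_real; apply: measurable_indic.
rewrite (_ : _ `\` _ = dom alpha `\` (dom alpha `&` [set t | 0 < cabs (f t)])).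
  by apply: measurableD; [exact: measurable_dom|exact: measurable_superlevel].
by rewrite setDIr setDv set0U.
Qed.

Lemma cabs_nonvanishing_gt0 f t : dom alpha t -> 0 < cabs (nonvanishing f t).
Proof.
move=> Dt; rewrite lt_neqAle cabs_ge0 andbT eq_sym cabs_eq0 nonvanishingE//.
by case: ifPn => //; rewrite oner_eq0.
Qed.

Lemma cabs_nonvanishing_le f t : dom alpha t ->
  cabs (nonvanishing f t) <= cabs (f t) + 1.
Proof.
move=> Dt; rewrite nonvanishingE//; case: ifPn => _; last by rewrite lerDl.
by rewrite (cabs_real 1) normr1 lerDr cabs_ge0.
Qed.

Lemma bounded_set_fin (D : set R) (N : R) : measurable D ->
  (forall t, D t -> 0 <= t <= N) -> (mu D < +oo)%E.
Proof.
move=> mD DN; apply: (@le_lt_trans _ _ (mu `[0, N]%classic)).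
  by apply: le_measure; rewrite ?inE// => t Dt /=; rewrite in_itv/= DN.
by rewrite lebesgue_measure_itv; case: ifP => _; rewrite ?ltry//= -EFinB ltry.
Qed.

Section weighted_mean.
Variables (D : set R) (w : R -> R) (N M : R).
Hypotheses (mD : measurable D) (D_gt0 : (0 < mu D)%E).
Hypothesis DN : forall t, D t -> 0 <= t <= N.
Hypothesis mw : measurable_fun D w.
Hypothesis w_gt0 : forall t, D t -> 0 < w t.
Hypothesis wM : forall t, D t -> w t <= M.

Let D_fin : (mu D < +oo)%E := bounded_set_fin mD DN.

Let I (P : {poly R}) : R := \int[mu]_(t in D) (P.[t] * w t).

Let measurable_weighted (P : {poly R}) : measurable_fun D (fun t => P.[t] * w t).
Proof.
apply: measurable_funM => //; apply: measurable_funTS.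
by apply: continuous_measurable_fun; exact: continuous_horner.
Qed.

Lemma weighted_poly_integrable (P : {poly R}) :
  mu.-integrable D (EFin \o (fun t => P.[t] * w t)).
Proof.
have [b Pb] := poly_itv_bound P 0 N.
apply: (@bounded_integrable _ _ (b * M)) => // t Dt.
rewrite normrM; apply: ler_pM => //; first exact/Pb/DN.
by rewrite gtr0_norm ?wM// w_gt0.
Qed.

Let I_linear (a : R) (P Q : {poly R}) : I (a *: P + Q) = a * I P + I Q.
Proof.
rewrite /I -RintegralZl//; last exact: weighted_poly_integrable.
rewrite -RintegralD//; last 2 first.
- by have := weighted_poly_integrable (a *: P); congr (integrable _ _ _);
    apply/funext => t /=; rewrite hornerZ mulrA.
- exact: weighted_poly_integrable.
by apply: eq_Rintegral => t _; rewrite hornerD hornerZ mulrDl mulrA.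
Qed.

Let I1_gt0 : 0 < I 1.
Proof.
rewrite lt_neqAle; apply/andP; split; last first.
  by apply: Rintegral_ge0 => t Dt; rewrite hornerC mul1r ltW// w_gt0.
apply/eqP => I0.
have : (\int[mu]_(t in D) `|(w t)%:E| = 0)%E.
  have fin : (\int[mu]_(t in D) (1.[t] * w t)%:E)%E \is a fin_num.
    by apply: integrable_fin_num => //; exact: (weighted_poly_integrable 1).
  transitivity (\int[mu]_(t in D) (1.[t] * w t)%:E)%E.
    apply: eq_integral => t /set_mem Dt.
    by rewrite hornerC mul1r gee0_abs// lee_fin ltW// w_gt0.
  by rewrite -(fineK fin); congr EFin; rewrite I0.
have mwE : measurable_fun D (EFin \o w) by exact/measurable_EFinP.
move=> w0; have {}w0 : ae_eq mu D (EFin \o w) (cst 0%E).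
  by apply/(ae_eq_integral_abs mu mD mwE); exact: w0.
have /negligibleP : mu.-negligible D.
  apply: negligibleS w0 => t Dt /= /(_ Dt)[] wt.
  by have := w_gt0 Dt; rewrite wt ltxx.
by move=> /(_ mD) D0; move: D_gt0; rewrite D0 ltxx.
Qed.

(** Center the monomials of degrees [1] to [k + 1] so that their weighted means
    vanish, subtract the average of the results so that they add up to zero, and
    scale.  Centering only affects the constant coefficients, so that those of
    degrees [1] to [k + 1] are, up to a factor, the vectors from the barycenter of a
    simplex to its vertices. *)
Lemma mean_zero_polys (k : nat) (eps : R) : 0 < eps ->
  exists2 P : 'I_k.+1 -> {poly R},
    [/\ forall i t, D t -> `|(P i).[t]| <= eps,
        forall i, \int[mu]_(t in D) ((P i).[t] * w t) = 0 &
        \sum_(i < k.+1) P i = 0] &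
    exists2 e, e != 0 & forall i j : 'I_k.+1,
      (P i)`_j.+1 = e * ((i == j)%:R - k.+1%:R^-1).
Proof.
move=> eps0.
(* The centered monomials and their deviations from their average. *)
pose p (i : 'I_k.+1) : {poly R} := 'X^(i.+1) - (I 'X^(i.+1) / I 1)%:P.
have Ip i : I (p i) = 0.
  by rewrite /p addrC -polyCN -alg_polyC I_linear mulNr divfK ?gt_eqF// addNr.
pose q i := p i - k.+1%:R^-1 *: \sum_(j < k.+1) p j.
have I0 : I 0 = 0.
  have := I_linear 1 0 0; rewrite scaler0 addr0 mul1r => /eqP.
  by rewrite -subr_eq subrr eq_sym => /eqP.
have Isum : I (\sum_(j < k.+1) p j) = 0.
  elim/big_rec: _ => // i P _ IP.
  by have := I_linear 1 (p i) P; rewrite scale1r => ->; rewrite Ip IP mulr0 addr0.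
have Iq i : I (q i) = 0.
  by rewrite /q addrC -scaleNr I_linear Ip Isum mulr0 addr0.
have [b qb] : exists b, forall i t, D t -> `|(q i).[t]| <= b.
  exists (\sum_(i < k.+1) `|sval (poly_itv_bound (q i) 0 N)|) => i t Dt.
  rewrite (bigD1 i)//=; apply: (@le_trans _ _ `|sval (poly_itv_bound (q i) 0 N)|).
    by apply: le_trans (ler_norm _); case: poly_itv_bound => ub /= ->//; exact: DN.
  by rewrite lerDl sumr_ge0.
pose e := eps / (`|b| + 1).
have b1 : 0 < `|b| + 1 by rewrite ltr_wpDl.
have e0 : 0 < e by rewrite divr_gt0.
exists (fun i => e *: q i); first split.
- move=> i t Dt; rewrite hornerZ normrM gtr0_norm// mulrC -ler_pdivlMr// /e.
  rewrite invf_div mulrCA divff ?gt_eqF// mulr1.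
  by apply: le_trans (qb i t Dt) _; apply: le_trans (ler_norm _) _; rewrite lerDl.
- by move=> i; have := I_linear e (q i) 0; rewrite addr0 Iq I0 mulr0 addr0.
- rewrite -scaler_sumr sumrB sumr_const card_ord -scaler_nat scalerA.
  by rewrite mulfV ?pnatr_eq0// scale1r subrr scaler0.
exists e; first by rewrite gt_eqF.
have pj i (j : 'I_k.+1) : (p i)`_j.+1 = (i == j)%:R.
  by rewrite coefB coefXn coefC/= subr0 eqSS eq_sym.
move=> i j; rewrite coefZ coefB coefZ pj coef_sum; congr (_ * (_ - _)).
rewrite (bigD1 j)//= pj eqxx big1 ?addr0 ?mulr1// => l /negbTE lj.
by rewrite pj lj.
Qed.

End weighted_mean.
End polynomial_perturbations.

(** * Rigidity of k-extreme points *)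

Section rigidity.
Context {R : realType} (alpha : \bar R) (g : R -> complex R).
Local Notation mu := (@lebesgue_measure R).
Hypothesis gL : L1_plus_Loo alpha g.
Hypothesis g_neq0 : ~ ae_on alpha (fun t => g t = 0).
Implicit Types f x : R -> complex R.

Let mg : L0 alpha g := gL.1.

Lemma sphereM_neq0 f : sphereM alpha g f -> ~ ae_on alpha (fun t => f t = 0).
Proof.
move=> [[mf _] f1] f0.
pose x (i : 'I_0) : R -> complex R := fun=> 0.
have mx i : L0 alpha (x i) by exact: L0_cst.
have xr i : (normM alpha g (x i) <= 0%:E)%E by case: i.
have := normM_lincomb gL g_neq0 (fun=> 0) mx xr.
rewrite -(@normM_ae _ _ _ f) //; last 2 first.
- by apply: L0_sum => i _; apply: L0M => //; exact: L0_cst.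
- by apply: ae_onS f0 => t _ ->; rewrite big_ord0.
by rewrite f1 big_ord0 lee_fin ler10.
Qed.

(** A [k]-extreme point admits no set [D] on which all small perturbations of zero
    weighted mean stay in the ball.  Otherwise perturb by the polynomials
    [mean_zero_polys]: their mean is [f], and a linear relation between them with
    coefficients [c_i] of sum [s] becomes, on [D], the vanishing of the polynomial
    [Q * (Q + s)] where [Q] is the same combination of the polynomials, the two
    factors corresponding to the zeros of [f] and to the other points.  So [Q] is
    constant, all [c_i] coincide, and the relation reads [s * f = 0]. *)
Lemma k_extreme_rigid k f (D : set R) (N M eps : R) : k_extreme alpha g k f ->
  measurable D -> D `<=` dom alpha -> (0 < mu D)%E ->
  (forall t, D t -> 0 <= t <= N) -> (forall t, D t -> cabs (f t) <= M) -> 0 < eps ->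
  ~ (forall h : R -> R, measurable_fun setT h -> (forall t, `|h t| <= eps) ->
      (forall t, ~ D t -> h t = 0) ->
      \int[mu]_(t in D) (h t * cabs (nonvanishing alpha f t)) = 0 ->
      ballM alpha g (fun t => f t + (h t)%:C%C * nonvanishing alpha f t)).
Proof.
move=> [sf kf] mD Ddom D0 DN fM eps0 H.
have mf : L0 alpha f by case: sf => -[].
pose u := nonvanishing alpha f; pose w t := cabs (u t).
have Lu : L0 alpha u := L0_nonvanishing mf.
have mw : measurable_fun D w.
  by apply: measurable_funS (L0_cabs Lu) => //; exact: measurable_dom.
have w0 t : D t -> 0 < w t by move=> /Ddom; exact: cabs_nonvanishing_gt0.
have wM t : D t -> w t <= M + 1.
  move=> Dt; apply: le_trans (cabs_nonvanishing_le _ (Ddom _ Dt)) _.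
  by rewrite lerD2r fM.
have [P [Peps Pmean Psum] [e e0 Pe]] := mean_zero_polys mD D0 DN mw w0 wM k eps0.
pose h i t := \1_D t * (P i).[t].
have hD i t : D t -> h i t = (P i).[t] by move=> Dt; rewrite /h indicE mem_set// mul1r.
have hC i t : ~ D t -> h i t = 0 by move=> Dt; rewrite /h indicE memNset// mul0r.
pose x i t := f t + (h i t)%:C%C * u t.
have bx i : ballM alpha g (x i).
  apply: H.
  - apply: measurable_funM; first exact: measurable_indic.
    by apply: continuous_measurable_fun; exact: continuous_horner.
  - move=> t; have [Dt|Dt] := pselect (D t); first by rewrite hD// Peps.
    by rewrite hC// normr0 ltW.
  - exact: hC.
  - rewrite -[RHS](Pmean i); apply: eq_Rintegral => t /set_mem Dt.
    by rewrite hD.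
have sumh t : \sum_(i < k.+1) (h i t)%:C%C = 0.
  by rewrite -rmorph_sum -mulr_sumr -horner_sum Psum horner0 mulr0 rmorph0.
have k1 : k.+1%:R != 0 :> complex R by rewrite pnatr_eq0.
have sumx t : \sum_(i < k.+1) x i t = k.+1%:R * f t.
  by rewrite big_split/= sumr_const card_ord -mulr_suml sumh mul0r addr0 mulr_natl.
have fx : ae_on alpha (fun t => f t = k.+1%:R^-1 * \sum_(i < k.+1) x i t).
  by apply: aeW => t _; rewrite sumx mulKf.
have [c [[i0 ci0] cx]] := kf x (sphereM_mean gL g_neq0 sf bx fx) fx.
pose s := \sum_i c i.
pose Q : {poly complex R} := \sum_i c i *: map_poly (real_complex R) (P i).
have QE t : D t -> Q.[t%:C%C] = \sum_i c i * (h i t)%:C%C.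
  move=> Dt; rewrite horner_sum; apply: eq_bigr => i _.
  by rewrite hornerZ horner_map hD.
have cxE t : \sum_i c i * x i t = s * f t + (\sum_i c i * (h i t)%:C%C) * u t.
  by rewrite !mulr_suml -big_split/=; apply: eq_bigr => i _; rewrite mulrDr mulrA.
have QQ : Q * (Q + s%:P) = 0.
  apply: (poly_ae_eq0 mD D0); move: cx.
  apply: (@filterS _ _ (ae_filter_ringOfSetsType mu)) => t + Dt.
  move=> /(_ (Ddom _ Dt)); rewrite cxE -QE// hornerM hornerD hornerC.
  rewrite /u nonvanishingE; last exact: Ddom.
  case: eqP => [->|/eqP ft].
    by rewrite mulr0 add0r mulr1 => ->; rewrite mul0r.
  by rewrite -mulrDl addrC => /eqP; rewrite mulf_eq0 (negbTE ft) orbF => /eqP ->;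
    rewrite mulr0.
have Qj (j : 'I_k.+1) : Q`_j.+1 = 0.
  move: QQ => /eqP; rewrite mulf_eq0 => /orP[/eqP->|]; first by rewrite coef0.
  by rewrite addr_eq0 => /eqP->; rewrite coefN coefC oppr0.
have PC (i j : 'I_k.+1) : ((P i)`_j.+1)%:C%C = e%:C%C * ((i == j)%:R - k.+1%:R^-1).
  by rewrite Pe rmorphM rmorphB fmorphV !rmorph_nat.
have cj j : c j = s / k.+1%:R.
  have := Qj j; rewrite coef_sum.
  rewrite (eq_bigr (fun i => e%:C%C * (c i * ((i == j)%:R - k.+1%:R^-1)))); last first.
    move=> i _; transitivity (c i * ((P i)`_j.+1)%:C%C); first by rewrite coefZ coef_map.
    by rewrite PC mulrCA.
  rewrite -mulr_sumr => /eqP; rewrite mulf_eq0 fmorph_eq0 (negbTE e0)/=.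
  under eq_bigr do rewrite mulrBr.
  rewrite sumrB -mulr_suml subr_eq0 => /eqP <-.
  rewrite (bigD1 j)//= eqxx mulr1 big1 ?addr0// => i /negbTE->.
  by rewrite mulr0.
have s0 : s != 0.
  by apply: contra ci0 => /eqP s0; rewrite cj s0 mul0r.
apply: (sphereM_neq0 sf); apply: ae_onS cx => t _.
rewrite (eq_bigr (fun i => s / k.+1%:R * x i t)) => [|i _]; last by rewrite cj.
rewrite -mulr_sumr sumx mulrA divfK// => /eqP.
by rewrite mulf_eq0 (negbTE s0)/= => /eqP.
Qed.

(** A set of positive measure is not the union of its null parts in [[0, n]]. *)
Lemma bounded_part (B : set R) : measurable B -> B `<=` dom alpha -> (0 < mu B)%E ->
  exists N : R, (0 < mu (B `&` `[0%R, N]%classic))%E.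
Proof.
move=> mB Bdom B0; apply: contrapT => H.
have {}H (n : nat) : mu.-negligible (B `&` `[0, n%:R]%classic).
  apply/negligibleP; first exact: measurableI.
  apply/eqP; rewrite eq_le measure_ge0 andbT leNgt; apply/negP => Bn.
  by apply: H; exists n%:R.
have /negligibleP : mu.-negligible B.
  apply: negligibleS (negligible_bigcup H) => t Bt.
  exists (Num.truncn t).+1 => //; split => //=; rewrite in_itv/=.
  by have [-> _] := Bdom _ Bt; rewrite ltW// truncnS_gt.
by move=> /(_ mB) BE; rewrite BE ltxx in B0.
Qed.

Lemma excess_local f x (D : set R) s (c : \bar R) : L0 alpha f -> L0 alpha x ->
  measurable D -> D `<=` dom alpha ->
  (forall t, ~ D t -> x t = f t) ->
  (\int[mu]_(t in D) (Num.max (cabs (x t) - s) 0)%:E <=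
   \int[mu]_(t in D) (Num.max (cabs (f t) - s) 0)%:E + c)%E ->
  (excess alpha x s <= excess alpha f s + c)%E.
Proof.
move=> mf mx mD Ddom xf xc.
have mC : measurable (dom alpha `\` D) by apply: measurableD => //; exact: measurable_dom.
have disj : [disjoint (dom alpha `\` D) & D].
  by apply/disj_set2P; rewrite setIC setDIK.
have split_excess y : L0 alpha y -> excess alpha y s =
    (\int[mu]_(t in dom alpha `\` D) (Num.max (cabs (y t) - s) 0)%:E +
     \int[mu]_(t in D) (Num.max (cabs (y t) - s) 0)%:E)%E.
  move=> my; rewrite -ge0_integral_setU//.
  - by rewrite setDKU.
  - by rewrite setDKU//; exact: measurable_excess_fun.
  - by move=> t _; rewrite lee_fin le_max lexx orbT.
have E : (\int[mu]_(t in dom alpha `\` D) (Num.max (cabs (x t) - s) 0)%:E =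
    \int[mu]_(t in dom alpha `\` D) (Num.max (cabs (f t) - s) 0)%:E)%E.
  by apply: eq_integral => t /set_mem[_ Dt]; rewrite xf.
have Ex := split_excess x mx; have Ef := split_excess f mf.
rewrite Ex Ef E; apply: le_trans (leeD2l _ xc) _.
by rewrite le_eqVlt; apply/orP; left; apply/eqP; exact: addeA.
Qed.

End rigidity.

(** * Perturbing the values of a function in a window *)

Section gaps.
Context {R : realType} (alpha : \bar R) (g : R -> complex R) (k : nat) (f : R -> complex R).
Local Notation mu := (@lebesgue_measure R).
Hypothesis gL : L1_plus_Loo alpha g.
Hypothesis g_neq0 : ~ ae_on alpha (fun t => g t = 0).
Hypothesis kf : k_extreme alpha g k f.
Local Notation d := (distr alpha).
Local Notation Phi := (excess alpha).
Local Notation u := (nonvanishing alpha f).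

Let mg : L0 alpha g := gL.1.
Let mf : L0 alpha f. Proof. by case: kf => -[[]]. Qed.
Let mdom : measurable (dom alpha) := measurable_dom alpha.
Let mu_u : L0 alpha u := L0_nonvanishing mf.

Let Phi_fg s : 0 <= s -> (Phi f s <= Phi g s)%E.
Proof.
move=> s0; have bf : ballM alpha g f by case: kf => -[fM f1] _; split => //; rewrite f1.
exact: (ballM_excess gL g_neq0 mf).1 bf _ s0.
Qed.

Let measurable_pert (h : R -> R) : measurable_fun setT h ->
  L0 alpha (fun t => f t + (h t)%:C%C * u t).
Proof.
move=> mh; apply: L0D => //; apply: L0M => //; apply: L0_real.
exact: measurable_funTS.
Qed.

(** If the excess of [f] at the bottom of the window of levels from [p] to [q] is
    still below that of [g] at its top, then the part of [f] with values in the
    window can be perturbed at will within a slightly larger window, as long as its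
    integral is kept: outside the window the excess does not change, inside it
    cannot get beyond its value at [p]. *)
Lemma k_extreme_gap p q : 0 <= p -> p < q -> (Phi f p < Phi g q)%E ->
  d f p = d f q.
Proof.
move=> p0 pq fg; apply/eqP; rewrite eq_le; apply/andP; split; last first.
  by apply: distr_le => //; exact: ltW.
rewrite leNgt; apply/negP => dqp.
have [r qr fgr] := excess_right_cont mg fg.
have [p1 pp1 dqp1] := distr_right_cont mf dqp.
have p1q : p1 < q.
  by rewrite ltNge; apply/negP => qp1; move: dqp1; rewrite ltNge distr_le.
have p1_gt0 : 0 < p1 by exact: le_lt_trans pp1.
pose B := (dom alpha `&` [set t | p1 < cabs (f t)]) `\`
  (dom alpha `&` [set t | q < cabs (f t)]).
have mB : measurable B by apply: measurableD; exact: measurable_superlevel.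
have B0 : (0 < mu B)%E.
  rewrite lt_neqAle measure_ge0 andbT; apply/eqP => B0.
  have : (d f p1 <= d f q + mu B)%E.
    rewrite /distr -measureU//; last 2 first.
    - exact: measurable_superlevel.
    - by rewrite setDIK.
    apply: le_measure; rewrite ?inE.
    - exact: measurable_superlevel.
    - by apply: measurableU => //; exact: measurable_superlevel.
    move=> t Dt; have [qt|qt] := pselect ((dom alpha `&` [set t | q < cabs (f t)]) t).
      by left.
    by right.
  by rewrite -B0 adde0 leNgt dqp1.
have [N BN] : exists N : R, (0 < mu (B `&` `[0%R, N]%classic))%E.
  by apply: (@bounded_part _ alpha) => // t [[]].
set D := B `&` _ in BN.
have mD : measurable D by exact: measurableI.
have Ddom : D `<=` dom alpha by move=> t [[[]]].
have DN t : D t -> 0 <= t <= N by move=> [_] /=; rewrite in_itv.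
have Df t : D t -> p1 < cabs (f t) <= q.
  move=> Dt; have [[[_ /= -> /=] nq] _] := Dt; rewrite leNgt; apply/negP => qt.
  by apply: nq; split => //; exact: Ddom.
have fin := bounded_set_fin mD DN.
(* On [D], where [p1 < |f| <= q], the factor [1 + h] with [|h| <= eps] keeps [|f|]
   between [p] and [r]. *)
pose eps := Num.min ((p1 - p) / p1) ((r - q) / q).
have q0 : 0 < q by exact: lt_trans p1q.
have eps0 : 0 < eps by rewrite lt_min !divr_gt0 ?subr_gt0.
apply: (k_extreme_rigid gL g_neq0 kf mD Ddom BN DN (M := q) (eps := eps)) => //.
  by move=> t /Df/andP[].
move=> h mh heps hD hint; set x := fun t => _.
have mx : L0 alpha x by exact: measurable_pert.
have xD t : D t -> cabs (x t) = cabs (f t) * (1 + h t) /\ p <= cabs (x t) <= r.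
  move=> Dt; have /andP[p1f fq] := Df t Dt.
  have f0 : f t != 0 by rewrite -cabs_eq0 gt_eqF// (lt_trans p1_gt0).
  have e1 : eps * p1 <= p1 - p by rewrite -ler_pdivlMr// ge_min lexx.
  have e2 : eps * q <= r - q by rewrite -ler_pdivlMr// ge_min lexx orbT.
  have := heps t; rewrite ler_norml => /andP[h1 h2].
  have eps1 : eps <= 1 by rewrite -(ler_pM2r p1_gt0) mul1r (le_trans e1)// lerBlDr lerDl.
  have xE : cabs (x t) = cabs (f t) * (1 + h t).
    rewrite /x nonvanishingE ?(negbTE f0); last exact: Ddom.
    rewrite -[X in cabs (X + _)]mul1r -mulrDl cabsM mulrC.
    rewrite (_ : 1 + (h t)%:C%C = (1 + h t)%:C%C) ?cabs_real ?rmorphD ?rmorph1//.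
    by rewrite ger0_norm//; lra.
  split => //; rewrite xE; have cf0 := cabs_ge0 (f t); apply/andP; split; nra.
have xf t : ~ D t -> x t = f t by move=> Dt; rewrite /x hD// rmorph0 mul0r addr0.
have intD s : s <= p -> (\int[mu]_(t in D) (Num.max (cabs (x t) - s) 0)%:E =
    \int[mu]_(t in D) (Num.max (cabs (f t) - s) 0)%:E)%E.
  move=> sp.
  have mfD : measurable_fun D (fun t => cabs (f t)) by apply: measurable_funS (L0_cabs mf).
  have mhD : measurable_fun D (fun t => h t * cabs (u t)).
    apply: measurable_funM; first exact: measurable_funTS.
    exact: measurable_funS (L0_cabs mu_u).
  have uE t : D t -> u t = f t.
    move=> Dt; rewrite nonvanishingE; last exact: Ddom.
    have /andP[p1f _] := Df t Dt.
    by case: eqP => // f0; move: p1f; rewrite f0 (cabs_real 0) normr0 ltNge ltW.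
  transitivity (\int[mu]_(t in D) ((cabs (f t) - s)%:E + (h t * cabs (u t))%:E))%E.
    apply: eq_integral => t /set_mem Dt; have [xE /andP[px _]] := xD t Dt.
    rewrite max_l ?subr_ge0 ?(le_trans sp)// -EFinD xE uE//; congr EFin; ring.
  have if1 : mu.-integrable D (EFin \o (fun t => cabs (f t) - s)).
    apply: (@bounded_integrable _ _ _ (q + `|s|)) => //; first exact: measurable_funB.
    move=> t /Df/andP[_ fq]; apply: le_trans (ler_normB _ _) _.
    by rewrite lerD2r ger0_norm// cabs_ge0.
  have if2 : mu.-integrable D (EFin \o (fun t => h t * cabs (u t))).
    apply: (@bounded_integrable _ _ _ (eps * q)) => // t Dt.
    have /andP[_ fq] := Df t Dt.
    by rewrite normrM uE// (ger0_norm (cabs_ge0 _)); apply: ler_pM => //; exact: cabs_ge0.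
  rewrite integralD//.
  have -> : (\int[mu]_(t in D) (h t * cabs (u t))%:E = 0)%E.
    rewrite -[RHS](congr1 EFin hint) fineK//; exact: integrable_fin_num.
  rewrite adde0; apply: eq_integral => t /set_mem Dt.
  have /andP[p1f _] := Df t Dt.
  by rewrite max_l// subr_ge0 (le_trans sp)// ltW// (lt_trans pp1).
have xle s : s <= p -> (Phi x s <= Phi f s)%E.
  move=> sp; rewrite -[X in (_ <= X)%E]adde0; apply: (excess_local mf mx mD) => //.
  by rewrite adde0 intD.
apply/(ballM_excess gL g_neq0 mx) => s s0.
have [sp|ps] := leP s p; first by apply: le_trans (xle s sp) _; exact: Phi_fg.
have [sr|rs] := leP s r.
  apply: le_trans (excess_le mx (ltW ps)) _; apply: le_trans (xle p (lexx p)) _.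
  by apply: le_trans (ltW fgr) _; exact: excess_le.
apply: (@le_trans _ _ (Phi f s)); last exact: Phi_fg.
rewrite -[X in (_ <= X)%E]adde0; apply: (excess_local mf mx mD) => //.
rewrite adde0 le_eqVlt; apply/orP; left; apply/eqP; apply: eq_integral => t /set_mem Dt.
have [_ /andP[_ xr]] := xD t Dt; have /andP[_ fq] := Df t Dt.
rewrite !max_r// subr_le0; first by apply: le_trans fq _; rewrite ltW// (lt_trans qr).
by rewrite (le_trans xr)// ltW.
Qed.

(** Levels at which the excess of [g] is infinite impose no constraint on a
    perturbation.  If this covers all levels below [r] except for some in [p, r]
    where there is room [e0] above the excess of [f], then the part of [f] with
    values up to [p] may be perturbed by any small function; so it is negligible. *)
Lemma k_extreme_floor p r e0 : 0 <= p -> p < r -> 0 < e0 ->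
  (forall s, 0 <= s < r ->
     Phi g s = +oo%E \/ (p <= s /\ (Phi f p + e0%:E <= Phi g s)%E)) ->
  mu (dom alpha `&` [set t | cabs (f t) <= p]) = 0%E.
Proof.
move=> p0 pr e00 room; set B := _ `&` _.
have mB : measurable B by exact: measurable_sublevel.
apply/eqP; rewrite eq_le measure_ge0 andbT leNgt; apply/negP => B0.
have [N BN] : exists N : R, (0 < mu (B `&` `[0%R, N]%classic))%E.
  by apply: (@bounded_part _ alpha) => // t [].
set D := B `&` _ in BN.
have mD : measurable D by exact: measurableI.
have Ddom : D `<=` dom alpha by move=> t [[]].
have DN t : D t -> 0 <= t <= N by move=> [_] /=; rewrite in_itv.
have Df t : D t -> cabs (f t) <= p by move=> [[]].
have fin := bounded_set_fin mD DN.
pose v := fine (mu D); have v0 : 0 < v by apply: fine_gt0; rewrite BN fin.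
have vE : mu D = v%:E by rewrite /v fineK// ge0_fin_numE.
(* The modulus grows by at most [eps * (p + 1)], hence does not exceed [r] on [D],
   and its integral over [D] grows by at most [e0]. *)
pose eps := Num.min (r - p) (e0 / v) / (p + 1).
have p1 : 0 < p + 1 by rewrite ltr_wpDl.
have eps0 : 0 < eps by rewrite divr_gt0// lt_min subr_gt0 pr divr_gt0.
apply: (k_extreme_rigid gL g_neq0 kf mD Ddom BN DN Df eps0) => h mh heps hD _.
set x := fun t => _.
have mx : L0 alpha x by exact: measurable_pert.
have xf t : ~ D t -> x t = f t by move=> Dt; rewrite /x hD// rmorph0 mul0r addr0.
pose b := Num.min (r - p) (e0 / v).
have xD t : D t -> cabs (x t) <= p + b.
  move=> Dt; apply: le_trans (cabsD _ _) _; apply: lerD; first exact: Df.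
  rewrite cabsM cabs_real; apply: (@le_trans _ _ (eps * (p + 1))).
    apply: ler_pM => //; first exact: cabs_ge0.
    by apply: le_trans (cabs_nonvanishing_le _ (Ddom _ Dt)) _; rewrite lerD2r Df.
  by rewrite /eps divfK// gt_eqF.
have br : b <= r - p by rewrite ge_min lexx.
have b0 : 0 < b by rewrite lt_min subr_gt0 pr divr_gt0.
have bv : b * v <= e0 by rewrite -ler_pdivlMr// ge_min lexx orbT.
apply/(ballM_excess gL g_neq0 mx) => s s0.
have [rs|sr] := leP r s.
  apply: (@le_trans _ _ (Phi f s)); last exact: Phi_fg.
  rewrite -[X in (_ <= X)%E]adde0; apply: (excess_local mf mx mD) => //.
  rewrite adde0 le_eqVlt; apply/orP; left; apply/eqP; apply: eq_integral => t /set_mem Dt.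
  have ft := Df t Dt; have xt := xD t Dt.
  by rewrite !max_r// subr_le0; lra.
have : 0 <= s < r by rewrite s0.
move=> /room[->|[ps pg]]; first exact: leey.
apply: le_trans (excess_le mx ps) _; apply: le_trans pg.
apply: (excess_local mf mx mD) => //.
apply: (@le_trans _ _ (\int[mu]_(t in D) cst b%:E t)%E).
  apply: ge0_le_integral => //.
  - by move=> t _; rewrite lee_fin le_max lexx orbT.
  - by apply: measurable_funS (measurable_excess_fun mx p).
  - move=> t Dt; have xt := xD t Dt.
    by rewrite lee_fin ge_max (ltW b0) andbT; lra.
rewrite integral_cst//=; apply: lee_paddl.
  by apply: integral_ge0 => t _; rewrite lee_fin le_max lexx orbT.
by move: vE => /= ->; rewrite -EFinM lee_fin.
Qed.

End gaps.

(** * Necessity: k-extreme points are rearrangements of the generator *)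

Lemma lte_fin_gap (R : realType) (x y : \bar R) : (0 <= x)%E -> (x < y)%E ->
  exists a e : R, [/\ x = a%:E, 0 < e & ((a + e)%:E < y)%E].
Proof.
case: x => [a _| _|//]; last by rewrite ltNge leey.
case: y => [b|_|//]; last by exists a, 1; rewrite ltry.
by rewrite lte_fin => ab; exists a, ((b - a) / 2); rewrite lte_fin; split => //; lra.
Qed.

Section necessity.
Context {R : realType} (alpha : \bar R) (g : R -> complex R) (k : nat) (f : R -> complex R).
Local Notation mu := (@lebesgue_measure R).
Hypothesis gL : L1_plus_Loo alpha g.
Hypothesis g_neq0 : ~ ae_on alpha (fun t => g t = 0).
Hypothesis kf : k_extreme alpha g k f.
Local Notation df := (distr alpha f).
Local Notation dg := (distr alpha g).
Local Notation Pf := (excess alpha f).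
Local Notation Pg := (excess alpha g).

Let mg : L0 alpha g := gL.1.
Let fM : inM alpha g f. Proof. by case: kf => -[]. Qed.
Let mf : L0 alpha f := fM.1.

Let Phi_fg s : 0 <= s -> (Pf s <= Pg s)%E.
Proof.
move=> s0; have bf : ballM alpha g f by case: kf => -[_ f1] _; split => //; rewrite f1.
exact: (ballM_excess gL g_neq0 mf).1 bf _ s0.
Qed.

(** Let [m] be the limit of the rearrangement.  Below [m] the distribution function of
    [f], and with it both excesses, are infinite, so [f] could be perturbed freely
    wherever [|f|] stays away from [m] from below. *)
Lemma k_extreme_ge_rearr_oo :
  ae_on alpha (fun t => (rearr_oo alpha f <= (cabs (f t))%:E)%E).
Proof.
have rho_oo t : (rearr_oo alpha f <= rearr alpha f t)%E.
  by rewrite rearr_ooE//; apply: ereal_inf_lbound; exists t.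
have [m m0 mE] : exists2 m, 0 <= m & rearr_oo alpha f = m%:E.
  have moo0 : (0 <= rearr_oo alpha f)%E.
    by rewrite rearr_ooE//; apply: le_ereal_inf_tmp => _ [t _ <-]; exact: rearr_ge0.
  have : (rearr_oo alpha f < +oo)%E.
    apply: le_lt_trans (rho_oo 1) _.
    by rewrite (rearr_fin mf ltr01 (inM_fin gL g_neq0 fM ltr01)) ltry.
  by case: (rearr_oo alpha f) moo0 => // m m0 _; exists m.
have Pgoo s : 0 <= s < m -> Pg s = +oo%E.
  move=> /andP[s0 sm]; apply/eqP; rewrite -leye_eq; apply: le_trans (Phi_fg s0).
  pose s' := (s + m) / 2.
  have ss' : s < s' by rewrite /s'; lra.
  have s'm : s' < m by rewrite /s'; lra.
  rewrite (excess_infty mf ss')//.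
  have td t : (t%:E < df s')%E.
    rewrite -lt_rearr//; last by apply: le_trans s0 (ltW ss').
    by apply: lt_le_trans (rho_oo t); rewrite mE lte_fin.
  have := distr_ge0 alpha f s'; case E : (df s') (td (fine (df s'))) => [r|//|//].
  by rewrite /= ltxx.
pose A n := dom alpha `&` [set t | cabs (f t) <= m - harmonic n].
have A0 n : mu.-negligible (A n).
  have [mn|mn] := ltP (m - harmonic n) 0.
    rewrite (_ : A n = set0); first exact: negligible_set0.
    by apply/seteqP; split => // t [_ ft];
      have := le_lt_trans (le_trans (cabs_ge0 _) ft) mn; rewrite ltxx.
  have h0 := @harmonic_gt0 R n.
  have : m - harmonic n < m by lra.
  move=> /(@k_extreme_floor _ _ _ _ _ gL g_neq0 kf _ _ 1 mn) /(_ ltr01) Am0.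
  exists (A n); split => //; last first.
    by apply: Am0 => s sm; left; exact: Pgoo.
  exact: measurable_sublevel.
apply: negligibleS (negligible_bigcup A0) => t /= /not_implyP[Dt].
rewrite mE lee_fin => /negP; rewrite -ltNge -subr_gt0 => /ltr_add_invr[n].
rewrite add0r => hn; exists n => //; split => //=.
by rewrite lerBrDl -lerBrDr ltW// /harmonic.
Qed.

Lemma excess_distr0 (h : R -> complex R) s : L0 alpha h -> 0 <= s -> distr alpha h s = 0%E ->
  excess alpha h s = 0%E.
Proof.
move=> mh s0 d0; rewrite excess_rearr//; apply: integral0_eq => t /=.
rewrite in_itv/= andbT => t0; apply: max_r.
by rewrite EFinN leeBlDr// add0e leNgt lt_rearr// d0 lte_fin -leNgt.
Qed.

(** At a level [s] where the excess of [f] is below that of [g], the excess of [f] is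
    affine, of slope [- distr alpha f s], as long as [|f|] takes no values there.  If [g] has
    the smaller distribution function, that of [g] decreases at most as fast, so that
    the difference persists upwards until the first values of [f] contradict
    [k_extreme_gap].  They are located by steps [eta] so short that the excess of [g]
    loses less than the difference over one more step. *)
Lemma gap_above s : 0 <= s -> (df s < +oo)%E -> (Pf s < Pg s)%E -> (dg s <= df s)%E ->
  False.
Proof.
move=> s0 dfin fg dgf.
have [a [e [aE e0 ae]]] := lte_fin_gap (excess_ge0 alpha f s) fg.
have [d dE] : exists d, df s = d%:E.
  by have := distr_ge0 alpha f s; move: dfin; case: (df s) => // d; exists d.
have d_ge0 : 0 <= d by rewrite -lee_fin -dE distr_ge0.
have d0 : 0 < d.
  rewrite lt_neqAle d_ge0 andbT; apply/eqP => d0.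
  have dg0 : dg s = 0%E.
    by apply/eqP; rewrite eq_le distr_ge0 andbT (le_trans dgf)// dE -d0.
  by move: fg; rewrite (excess_distr0 mg s0 dg0) ltNge excess_ge0.
pose eta := e / d; have eta0 : 0 < eta by rewrite divr_gt0.
have etad : eta * d = e by rewrite /eta divfK// gt_eqF.
have down n : (Pf (s + n%:R * eta) + (n%:R * eta)%:E * df (s + n%:R * eta) <= a%:E)%E.
  have := @excess_distr_le _ _ _ mf s (s + n%:R * eta).
  rewrite (_ : s + n%:R * eta - s = n%:R * eta); last by rewrite addrAC subrr add0r.
  by rewrite -aE; apply; rewrite lerDl mulr_ge0// ltW.
have exn : exists n, (df (s + n%:R * eta)%R < d%:E)%E.
  pose n := (Num.truncn (a / e)).+1; exists n.
  rewrite ltNge; apply/negP => dn.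
  have : ((n%:R * eta)%:E * d%:E <= a%:E)%E.
    apply: le_trans (down n); apply: lee_paddl; first exact: excess_ge0.
    by apply: lee_wpmul2l => //; rewrite lee_fin mulr_ge0// ltW.
  rewrite -EFinM lee_fin -mulrA etad -ler_pdivlMr// leNgt => /negP; apply.
  by rewrite truncnS_gt.
case: (ex_minnP exn) => [[|n] dn nmin].
  by move: dn; rewrite mul0r addr0 dE ltxx.
pose p := s + n%:R * eta; pose q := s + n.+1%:R * eta.
have sp : s <= p by rewrite lerDl mulr_ge0// ltW.
have qp : q = p + eta by rewrite /p /q -natr1 mulrDl mul1r addrA.
have dp : df p = d%:E.
  apply/eqP; rewrite eq_le -{1}dE distr_le//= leNgt; apply/negP => /nmin.
  by rewrite ltnn.
have p_ge0 : 0 <= p by exact: le_trans sp.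
have pq : p < q by rewrite qp ltrDl.
suff fgpq : (Pf p < Pg q)%E.
  by move: dn; rewrite -/q -(k_extreme_gap gL g_neq0 kf p_ge0 pq fgpq) dp ltxx.
rewrite ltNge; apply/negP => gfpq.
have fp := excess_distr_le mf sp; rewrite dp aE in fp.
have gq := excess_le_distr mg (ltW (le_lt_trans sp pq)).
move: fp gq gfpq ae; have := excess_ge0 alpha f p; have := excess_ge0 alpha g q.
have : ((q - s)%:E * dg s <= (q - s)%:E * d%:E)%E.
  by apply: lee_wpmul2l; rewrite ?lee_fin ?subr_ge0 -?dE// (le_trans sp)// ltW.
move=> dgq gq0 fp0 fp gq gfpq ae.
have {}gq : (Pg s <= Pg q + (q - s)%:E * d%:E)%E by apply: le_trans gq _; rewrite leeD2l.
have {ae}gq : ((a + e)%:E < Pg q + (q - s)%:E * d%:E)%E by apply: lt_le_trans gq.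
move: fp0 gq0 gfpq fp gq; case: (Pf p) => // b.
case: (Pg q) => // c _ _; rewrite -!EFinM -!EFinD !(lee_fin, lte_fin) => cb.
have -> : (q - s) * d = (p - s) * d + e by rewrite qp -etad; ring.
lra.
Qed.

(** If [g] has the larger distribution function, the difference of the excesses
    persists downwards to [p], the lowest level with the distribution value of [s].
    If the excess of [g] is infinite below [p], [k_extreme_floor] shows that [|f|]
    exceeds [p] everywhere, and then no distribution function can be larger.
    Otherwise [f] takes values arbitrarily close below [p] or equal to [p], against
    [k_extreme_gap]. *)
Lemma gap_below s : 0 <= s -> (Pf s < Pg s)%E -> (df s < dg s)%E -> False.
Proof.
move=> s0 fg dfg.
have [a [e [aE e0 ae]]] := lte_fin_gap (excess_ge0 alpha f s) fg.
have [d dE] : exists d, df s = d%:E.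
  have := distr_ge0 alpha f s; move: dfg; case: (df s) => // [d|]; first by exists d.
  by rewrite ltNge leey.
have d_ge0 : 0 <= d by rewrite -lee_fin -dE distr_ge0.
pose S := [set r : R | 0 <= r /\ (df r <= d%:E)%E].
have Ss : S s by split => //; rewrite dE.
have lS : lbound S 0 by move=> r [].
have hS : has_inf S by split; [exists s|exists 0].
pose p := inf S.
have p0 : 0 <= p by apply: lb_le_inf => //; exists s.
have ps : p <= s by apply: ge_inf => //; exists 0.
have dp : df p = d%:E.
  apply/eqP; rewrite eq_le -{2}dE distr_le// andbT leNgt; apply/negP => dp.
  have [r pr dr] := distr_right_cont mf dp.
  have : r <= p.
    apply: lb_le_inf; first by exists s.
    move=> r' [r'0 dr']; rewrite leNgt; apply/negP => r'r.
    by move: dr; rewrite ltNge (le_trans _ dr')// distr_le// ltW.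
  by rewrite leNgt pr.
have [b bE b_le] : exists2 b, Pf p = b%:E & b <= a + (s - p) * d.
  have := excess_le_distr mf ps; rewrite dp aE; have := excess_ge0 alpha f p.
  by case: (Pf p) => // b _; rewrite -EFinM -EFinD lee_fin => h; exists b.
have bg : ((b + e)%:E < Pg p)%E.
  apply: (@le_lt_trans _ _ ((a + e)%:E + (s - p)%:E * d%:E)%E).
    by rewrite -EFinM -EFinD lee_fin; lra.
  apply: lt_le_trans (excess_distr_le mg ps).
  apply: (@lt_le_trans _ _ (Pg s + (s - p)%:E * d%:E)%E).
    by rewrite -EFinM lteD2rE.
  by rewrite leeD2l// lee_wpmul2l// ?lee_fin ?subr_ge0// -dE ltW.
have [goo|] := pselect (forall r, 0 <= r < p -> Pg r = +oo%E).
  have [r pr br] := excess_right_cont mg bg.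
  have floor0 : mu (dom alpha `&` [set t | cabs (f t) <= p]) = 0%E.
    apply: (k_extreme_floor gL g_neq0 kf p0 pr e0) => q /andP[q0 qr].
    have [qp|pq] := ltP q p; first by left; apply: goo; rewrite q0.
    by right; split => //; rewrite bE -EFinD (le_trans (ltW br))// excess_le// ltW.
  suff : (mu (dom alpha) <= df p)%E.
    rewrite dp -dE leNgt => /negP; apply; apply: lt_le_trans dfg _.
    exact: distr_le_dom.
  rewrite -[X in (_ <= X)%E]add0e -floor0.
  have mfl : measurable (dom alpha `&` [set t | cabs (f t) <= p]).
    exact: measurable_sublevel.
  rewrite /distr -measureU//; last 2 first.
  - exact: measurable_superlevel.
  - by apply/seteqP; split => // t [[_ /= h] [_ /=]]; rewrite ltNge h.
  apply: le_measure; rewrite ?inE.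
  - exact: measurable_dom.
  - by apply: measurableU => //; exact: measurable_superlevel.
  by move=> t Dt; have [h|h] := leP (cabs (f t)) p; [left|right].
move=> /existsNP[r /not_implyP[/andP[r0 rp] goo]].
have fr : (Pf r < +oo)%E.
  by apply: le_lt_trans (Phi_fg r0) _; rewrite ltey; exact/eqP.
pose r' := (r + p) / 2; have rr' : r < r' by rewrite /r'; lra.
have r'p : r' < p by rewrite /r'; lra.
have [B B0 BE] : exists2 B, 0 <= B & df r' = B%:E.
  have := distr_fin mf rr' fr; have := distr_ge0 alpha f r'.
  by case: (df r') => // B B0 _; exists B.
(* Between [r'] and [p] the excess of [f] has slope at most [B], so that it gains at
   most [e] from [p] down to [p']. *)
pose p' := Num.max r' (p - e / (B + 1)).
have B1 : 0 < B + 1 by rewrite ltr_wpDl.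
have eB : 0 < e / (B + 1) by rewrite divr_gt0.
have p'p : p' < p by rewrite gt_max r'p/= gtrDl oppr_lt0.
have r'p' : r' <= p' by rewrite le_max lexx.
have pp'e : p - p' <= e / (B + 1) by rewrite lerBlDr -lerBlDl le_max lexx orbT.
have p'0 : 0 <= p' by apply: le_trans r'p'; apply: le_trans (ltW rr').
have fgp : (Pf p' < Pg p)%E.
  apply: le_lt_trans bg; apply: le_trans (excess_le_distr mf (ltW p'p)) _.
  apply: (@le_trans _ _ (b%:E + (p - p')%:E * B%:E)%E).
    rewrite bE leeD2l// lee_wpmul2l// ?lee_fin ?subr_ge0 ?(ltW p'p)// -BE.
    exact: distr_le.
  rewrite -EFinM -EFinD lee_fin lerD2l.
  apply: (@le_trans _ _ (e / (B + 1) * (B + 1))); last by rewrite divfK// gt_eqF.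
  apply: ler_pM => //; first by rewrite subr_ge0 ltW.
  by rewrite lerDl.
have := k_extreme_gap gL g_neq0 kf p'0 p'p fgp; rewrite dp => dp'.
have : p <= p' by apply: ge_inf; [exists 0|split => //; rewrite dp'].
by rewrite leNgt p'p.
Qed.

Lemma k_extreme_excess_ge s : 0 <= s -> (Pg s <= Pf s)%E.
Proof.
move=> s0; rewrite leNgt; apply/negP => fg.
have [s' ss' fg'] := excess_right_cont mg fg.
have s'0 : 0 <= s' by exact: le_trans (ltW ss').
have fgs' : (Pf s' < Pg s')%E by apply: le_lt_trans fg'; exact: excess_le (ltW ss').
have [dgf|dfg] := leP (dg s') (df s'); last exact: gap_below dfg.
apply: gap_above dgf => //; apply: (distr_fin mf ss').
by apply: lt_le_trans fg _; exact: leey.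
Qed.

End necessity.

Section recovery.
Context {R : realType} (alpha : \bar R) (g : R -> complex R).
Hypothesis gL : L1_plus_Loo alpha g.
Hypothesis g_neq0 : ~ ae_on alpha (fun t => g t = 0).
Implicit Types f h : R -> complex R.

(** For [t > distr alpha f s] the rearrangement at [t] is at most [s], and the excess
    over it is at most the partial integral at [t]. *)
Lemma excess_fin_distr f s : inM alpha g f -> 0 <= s ->
  (distr alpha f s < +oo)%E -> (excess alpha f s < +oo)%E.
Proof.
move=> fM s0 ds; have mf := fM.1.
pose t := fine (distr alpha f s) + 1.
have t0 : 0 < t by rewrite ltr_wpDl// fine_ge0// distr_ge0.
have Ft := inM_fin gL g_neq0 fM t0.
apply: le_lt_trans (excess_fin_rearr mf t0 Ft); apply: excess_le => //.
rewrite -lee_fin -rearr_fin// leNgt lt_rearr// -leNgt.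
by rewrite -[X in (X <= _)%E]fineK ?ge0_fin_numE ?distr_ge0// lee_fin lerDl.
Qed.

(** The distribution function is minus the right derivative of the excess, wherever
    the latter is finite. *)
Lemma distr_le_of_excess f h s : inM alpha g f -> inM alpha g h -> 0 <= s ->
  (forall r, 0 <= r -> excess alpha f r = excess alpha h r) ->
  (distr alpha f s <= distr alpha h s)%E.
Proof.
move=> fM hM s0 fh; have mf := fM.1; have mh := hM.1.
rewrite leNgt; apply/negP => hf.
have [s' ss' hf'] := distr_right_cont mf hf.
have hfin : (distr alpha h s < +oo)%E by apply: lt_le_trans hf _; exact: leey.
have s'0 : 0 <= s' by exact: le_trans (ltW ss').
have Pfin : (excess alpha f s' < +oo)%E.
  rewrite fh//; apply: excess_fin_distr => //.
  by apply: le_lt_trans (distr_le mh (ltW ss')) _.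
have fs := excess_distr_le mf (ltW ss').
rewrite (fh s)// (fh s')// in fs Pfin.
have := le_trans fs (excess_le_distr mh (ltW ss')).
rewrite leeD2lE ?ge0_fin_numE ?excess_ge0// lee_pmul2l// ?lte_fin ?subr_gt0//.
by rewrite leNgt hf'.
Qed.

Lemma rearr_eq_distr f h t : (forall s, 0 < s -> distr alpha f s = distr alpha h s) ->
  rearr alpha f t = rearr alpha h t.
Proof.
move=> fh; rewrite /rearr; apply: (congr1 (@ereal_inf R)); apply/seteqP.
by split => _ [s [s0 ds] <-]; exists s => //; split => //; move: ds; rewrite fh.
Qed.

End recovery.

Theorem corollary4p2 (R : realType) (alpha : \bar R) (g : R -> complex R) (k : nat)
    (alpha_gt0 : (0 < alpha)%E)
    (gL : L1_plus_Loo alpha g)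
    (g_neq0 : ~ ae_on alpha (fun t => g t = 0))
    (k_gt0 : (0 < k)%N)
    (f : R -> complex R) (fM : inM alpha g f) :
  (k_extreme alpha g k f <->
     (forall t : R, 0 <= t -> rearr alpha f t = rearr alpha g t) /\
     ae_on alpha (fun t => (rearr_oo alpha f <= (cabs (f t))%:E)%E)) /\
  (k_extreme alpha g k f <-> extreme alpha g f).
Proof.
have gM : inM alpha g g.
  split; first by case: gL.
  apply: (@le_lt_trans _ _ 1%E); last exact: ltry.
  by apply/(normM_le gL g_neq0) => t _; rewrite mul1e.
have nec : k_extreme alpha g k f ->
    (forall t : R, 0 <= t -> rearr alpha f t = rearr alpha g t) /\
    ae_on alpha (fun t => (rearr_oo alpha f <= (cabs (f t))%:E)%E).
  move=> kf; split; last exact: k_extreme_ge_rearr_oo kf.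
  have Pfg s : 0 <= s -> excess alpha f s = excess alpha g s.
    move=> s0; apply/eqP; rewrite eq_le (k_extreme_excess_ge gL g_neq0 kf)// andbT.
    have bf : ballM alpha g f by case: kf => -[_ f1] _; split => //; rewrite f1.
    exact: (ballM_excess gL g_neq0 fM.1).1 bf _ s0.
  move=> t _; apply: rearr_eq_distr => s /ltW s0.
  apply/eqP; rewrite eq_le (distr_le_of_excess gL g_neq0 fM gM)//.
  by rewrite (distr_le_of_excess gL g_neq0 gM fM)// => r r0; rewrite Pfg.
have suf : (forall t : R, 0 <= t -> rearr alpha f t = rearr alpha g t) /\
    ae_on alpha (fun t => (rearr_oo alpha f <= (cabs (f t))%:E)%E) -> extreme alpha g f.
  by move=> [fg foo]; exact: equimeasurable_extreme.
have ext : extreme alpha g f -> k_extreme alpha g k f by exact: extreme_k_extreme.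
split; split => [kf|H]; [exact: nec|exact/ext/suf|exact/suf/nec|exact: ext].
Qed.
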